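(* Let $\Bbbk$ be a field, $R=\Bbbk[x_1,\ldots,x_d]$ the standard graded polynomial ring and $\mathfrak m=(x_1,\ldots,x_d)$. Let $\mathbb I=\{I_n\}_{n\in\mathbb N}$ be a (not necessarily Noetherian) graded family of $\mathfrak m$-primary monomial ideals and let $\mathbb J(1)=\{J(1)_n\}_{n\in\mathbb N},\ldots,\mathbb J(r)=\{J(r)_n\}_{n\in\mathbb N}$ be (not necessarily Noetherian) graded families of monomial ideals in $R$. Assume that there exists $\beta\in\mathbb N$ with $\beta(J(i)_n)\le\beta n$ for all $1\le i\le r$ and all $n\in\mathbb N$. Then for each $d_0\in\mathbb N$ and $\mathbf d=(d_1,\ldots,d_r)\in\mathbb N^r$ with $d_0+|\mathbf d|=d-1$, $$e_{(d_0,\mathbf d)}\big(\mathbb I\mid\mathbb J(1),\ldots,\mathbb J(r)\big)=\lim_{p\to\infty}\frac{e_{(d_0,\mathbf d)}\big(I_p\mid J(1)_p,\ldots,J(r)_p\big)}{p^d}.$$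
   Context: $\mathbb N$ contains $0$; $|\mathbf d|=d_1+\cdots+d_r$, $\mathbf d!=d_1!\cdots d_r!$, $\mathbf n^{\mathbf d}=n_1^{d_1}\cdots n_r^{d_r}$. A graded family of ideals is a sequence $\{I_n\}_{n\in\mathbb N}$ with $I_0=R$ and $I_iI_j\subseteq I_{i+j}$ for all $i,j$; it is a graded family of $\mathfrak m$-primary (resp. monomial) ideals if $I_n$ is $\mathfrak m$-primary for all $n>0$ (resp. monomial for all $n$). It is Noetherian if $\bigoplus_nI_nt^n\subseteq R[t]$ is Noetherian. For a homogeneous ideal $J$, $\beta(J)=\max\{j\mid [J\otimes_R\Bbbk]_j\neq 0\}$, that is, the maximum degree of a minimal set of homogeneous generators of $J$. Mixed multiplicities of families: under the stated hypotheses the function $$F(n_0,\mathbf n)=\lim_{m\to\infty}\frac{\dim_{\Bbbk}\big(J(1)_{mn_1}\cdots J(r)_{mn_r}/I_{mn_0}J(1)_{mn_1}\cdots J(r)_{mn_r}\big)}{m^d}$$ agrees for all $n_0\in\mathbb N,\mathbf n\in\mathbb N^r$ with a homogeneous real polynomial of total degree $d$, all of whose terms are divisible by $n_0$. The mixed multiplicities $e_{(d_0,\mathbf d)}(\mathbb I\mid\mathbb J(1),\ldots,\mathbb J(r))\ge0$, for $d_0+|\mathbf d|=d-1$, are the real numbers defined by $$F(n_0,\mathbf n)=\sum_{d_0+|\mathbf d|=d-1}\frac{1}{(d_0+1)!\,\mathbf d!}\,e_{(d_0,\mathbf d)}(\mathbb I\mid\mathbb J(1),\ldots,\mathbb J(r))\,n_0^{d_0+1}\mathbf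 n^{\mathbf d}.$$ Mixed multiplicities of ideals: for an $\mathfrak m$-primary homogeneous ideal $I$ and homogeneous ideals $J_1,\ldots,J_r$ of $R$, the integers $e_{(d_0,\mathbf d)}(I\mid J_1,\ldots,J_r)\ge0$ are defined by $$\lim_{m\to\infty}\frac{\dim_{\Bbbk}\big(J_1^{mn_1}\cdots J_r^{mn_r}/I^{mn_0}J_1^{mn_1}\cdots J_r^{mn_r}\big)}{m^d}=\sum_{d_0+|\mathbf d|=d-1}\frac{e_{(d_0,\mathbf d)}(I\mid J_1,\ldots,J_r)}{(d_0+1)!\,\mathbf d!}\,n_0^{d_0+1}\mathbf n^{\mathbf d}\quad\text{for all }n_0,\ldots,n_r\ge0.$$ *)

(* Defs.v *)
From HB Require Import structures.
From mathcomp Require Import all_boot all_order all_algebra.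
From mathcomp Require Import mpoly.
From mathcomp Require Import boolp classical_sets functions reals topology
  normedtype sequences.

Set Implicit Arguments.
Unset Strict Implicit.
Unset Printing Implicit Defensive.

Import Order.TTheory GRing.Theory Num.Theory.
Import numFieldNormedType.Exports.

Local Open Scope classical_set_scope.
Local Open Scope ring_scope.

Section Ideals.
Context {A : comNzRingType}.
Implicit Types I J : set A.

Definition is_ideal I : Prop :=
  [/\ I 0, forall f g, I f -> I g -> I (f + g) & forall a f, I f -> I (a * f)].

(* Finite sums of products f * g with f in I and g in J: for ideals this is the
   product ideal, and for I = setT it is the ideal generated by the set J. *)
Definition idealM I J : set A :=
  [set h | exists s : seq (A * A),
     (forall u, u \in s -> I u.1 /\ J u.2) /\ h = \sum_(u <- s) u.1 * u.2].

Definition ideal_gen (S : set A) : set A := idealM setT S.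

Definition idealX I (n : nat) : set A := iter n (idealM I) setT.

Definition radical I : set A := [set f | exists n : nat, I (f ^+ n)].

Definition primary_ideal I : Prop :=
  [/\ is_ideal I, ~ I 1 &
      forall f g, I (f * g) -> I f \/ exists n : nat, I (g ^+ n)].

Definition graded_family (I : nat -> set A) : Prop :=
  [/\ forall n, is_ideal (I n), I 0%N = setT &
      forall i j : nat, idealM (I i) (I j) `<=` I (i + j)%N].

End Ideals.

Section PolynomialRing.
Context {k : fieldType} {d : nat}.
Implicit Types I J : set {mpoly k[d]}.

Definition irrelevant_ideal : set {mpoly k[d]} :=
  ideal_gen [set 'X_i | i in [set: 'I_d]].

Definition m_primary I : Prop :=
  primary_ideal I /\ radical I = irrelevant_ideal.

Definition monomial_ideal I : Prop :=
  exists M : set 'X_{1..d}, I = ideal_gen [set 'X_[m] | m in M].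

(* [J (x) k]_j <> 0, where J (x) k = J / mJ: for J homogeneous, its degree j
   part consists of the classes of the forms of degree j in J. *)
Definition gen_degree J (j : nat) : Prop :=
  exists f, [/\ f \is j.-homog, J f & ~ idealM irrelevant_ideal J f].

(* beta(J) = b.  The maximum exists only if J <> 0, so the zero ideal has no
   beta. *)
Definition is_beta J (b : nat) : Prop :=
  gen_degree J b /\ forall j, gen_degree J j -> (j <= b)%N.

End PolynomialRing.

Section QuotientDimension.
Context {k : fieldType} {V : lmodType k}.

(* V1 / V2 has a basis of n elements, given by representatives in V1. *)
Definition is_quot_dim (V1 V2 : set V) (n : nat) : Prop :=
  exists b : 'I_n -> V,
    [/\ forall i, V1 (b i),
        forall c : 'I_n -> k, V2 (\sum_i c i *: b i) -> forall i, c i = 0 &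
        forall v, V1 v -> exists c : 'I_n -> k, V2 (v - \sum_i c i *: b i)].

(* dim_k (V1 / V2) for subspaces V2 of V1; 0 if the quotient is not
   finite-dimensional. *)
Definition quot_dim (V1 V2 : set V) : nat := xget 0%N (is_quot_dim V1 V2).

End QuotientDimension.

Section MixedMultiplicities.
Context (R : realType) {k : fieldType} {d r : nat}.
Implicit Types (I : nat -> set {mpoly k[d]})
  (J : 'I_r -> nat -> set {mpoly k[d]}).

(* J(1)_{m n_1} ... J(r)_{m n_r} *)
Definition prod_family J (n : 'I_r -> nat) (m : nat) : set {mpoly k[d]} :=
  \big[idealM/setT]_(i < r) J i (m * n i)%N.

(* \sum_(d0 + |dd| = d - 1) e (d0, dd) / ((d0 + 1)! dd!) n0 ^ (d0 + 1) n ^ dd;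
   all exponents are less than d, whence the index types. *)
Definition mixed_poly (e : nat -> ('I_r -> nat) -> R) (n0 : nat)
    (n : 'I_r -> nat) : R :=
  \sum_(d0 < d) \sum_(dd : {ffun 'I_r -> 'I_d}
                      | (d0 + \sum_(i < r) dd i).+1 == d)
    e d0 (fun i => dd i) / (d0.+1`! * \prod_(i < r) (dd i)`!)%:R
    * n0%:R ^+ d0.+1 * \prod_(i < r) (n i)%:R ^+ dd i.

Definition is_mixed_mult I J (e : nat -> ('I_r -> nat) -> R) : Prop :=
  forall (n0 : nat) (n : 'I_r -> nat),
    (fun m : nat =>
       (quot_dim (prod_family J n m)
          (idealM (I (m * n0)%N) (prod_family J n m)))%:R / m%:R ^+ d : R)
      @ \oo --> mixed_poly e n0 n.

(* e_(d0, dd)(I | J(1), ..., J(r)) for graded families.  is_mixed_mult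
   determines the values of e at the (d0, dd) with d0 + |dd| = d - 1, the
   only ones that are meaningful here. *)
Definition mixed_mult I J : nat -> ('I_r -> nat) -> R :=
  xget (fun _ _ => 0) (is_mixed_mult I J).

(* e_(d0, dd)(I | J_1, ..., J_r) for ideals: the defining limit is the one
   above for the families of powers. *)
Definition mixed_mult_ideals (I : set {mpoly k[d]})
    (J : 'I_r -> set {mpoly k[d]}) : nat -> ('I_r -> nat) -> R :=
  mixed_mult (idealX I) (fun i => idealX (J i)).

End MixedMultiplicities.

Arguments mixed_poly [R] d {r} e n0 n.

(* Main.v *)
Require Import Defs.
From HB Require Import structures.
From mathcomp Require Import all_boot all_order all_algebra.
From mathcomp Require Import zify ring lra mpoly.
From mathcomp Require Import boolp classical_sets functions reals topology
  normedtype sequences.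

Set Implicit Arguments.
Unset Strict Implicit.
Unset Printing Implicit Defensive.

Import Order.TTheory GRing.Theory Num.Theory.
Import numFieldNormedType.Exports.

Local Open Scope classical_set_scope.
Local Open Scope ring_scope.

(** Monomial ideals are up-sets of exponents, products of ideals are Minkowski
    sums, and the dimension of a quotient of monomial ideals is a number of lattice
    points. Write [nu = (n0, n)] and let [A(nu)] be the set of exponents of
    [I_{n0} J(1)_{n1} ... J(r)_{nr}]. Since generators have degrees bounded
    linearly, there is [C] such that the dimension to be estimated is the
    difference of two truncated counts [T(nu)], the number of points of degree at
    most [C |nu|] in such a set: one for the family with [I] replaced by the
    constant family [R], and one for the given family ([quot_dim_join]).

    So everything reduces to the behaviour of [T(m nu) / m^d]. Its limit is the
    volume of a truncated Minkowski sum of convex bodies, but no convex geometry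
    is needed. The [D]-fold sum of an up-set [P] contains, for each [x] in [P],
    the discrete cube [D x + {0, ..., D - 1}^d], and these cubes are disjoint;
    hence the [D]-fold sum has at least [D^d |P|] points, up to a boundary layer
    of lower order ([count_upto_nfold]). With monotonicity, this superadditivity
    forces convergence by an argument in the manner of Fekete ([growth_cvg],
    [vol_cvg]), and it also shows that the limit [V_p] attached to the families of
    powers of the [p]-th members satisfies [V_p / p^d --> V] ([vol_power_cvg]):
    a large [p]-th member contains many sums of elements of a fixed [q]-th one.

    The volume [V_p] is polynomial in [nu] by the theorem of Khovanskii: the
    cardinal of a sumset [nu_1 K_1 + ... + nu_s K_s] of finite sets is eventually
    a polynomial in [nu] ([eventually_poly_trunc_count]). Each element of the
    sumset has a unique minimal representation by the generators; the
    representations that are not minimal form an up-set, which is finitely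
    generated by Dickson's lemma, and the complement of a finitely generated
    up-set is counted by inclusion-exclusion. Being polynomial of bounded degree
    can be tested by interpolation on finitely many values, so it passes to
    pointwise limits ([is_poly_cvg]); together with homogeneity this makes first
    [V_p] and then [V] homogeneous polynomials of degree [d].

    Therefore both kinds of mixed multiplicities exist and are, up to the same
    factorials, coefficients of the difference of the volumes attached to the two
    families above ([mixed_mult_coef]). Coefficients are linear combinations of
    finitely many values, so the pointwise convergence of [V_p / p^d] gives the
    theorem. *)

(** * Counting monomials of bounded degree in up-sets *)

Definition count_upto (n : nat) (P : set 'X_{1..n}) (L : nat) : nat :=
  #|[set x : 'X_{1..n < L.+1} | `[< P x >]]%SET|.

Lemma count_upto_inj (n n' : nat) (P : set 'X_{1..n}) (Q : set 'X_{1..n'}) L L'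
    (f : 'X_{1..n} -> 'X_{1..n'}) :
  (forall x, P x -> (mdeg x <= L)%N -> Q (f x) /\ (mdeg (f x) <= L')%N) ->
  (forall x y, P x -> P y -> (mdeg x <= L)%N -> (mdeg y <= L)%N ->
     f x = f y -> x = y) ->
  (count_upto P L <= count_upto Q L')%N.
Proof.
move=> fP f_inj; rewrite /count_upto.
pose g (x : 'X_{1..n < L.+1}) : 'X_{1..n' < L'.+1} := insubd (@bm0 n' L') (f x).
have gE (x : 'X_{1..n < L.+1}) : P x -> bmnm (g x) = f x.
  move=> Px; have [_ le_fx] := fP x Px (bmdeg x).
  by rewrite /g /insubd insubT.
rewrite -(card_in_imset (f := g)) => [|x y].
  apply/subset_leq_card/fintype.subsetP => _ /imsetP[x + ->].
  rewrite !finset.inE => /asboolP Px; apply/asboolP; rewrite gE //.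
  by case: (fP x Px (bmdeg x)).
rewrite !finset.inE => /asboolP Px /asboolP Py /(congr1 (@bmnm n' L'.+1)).
by rewrite !gE // => /(f_inj _ _ Px Py (bmdeg x) (bmdeg y))/val_inj.
Qed.

Lemma count_uptoID (n : nat) (P Q : set 'X_{1..n}) L :
  count_upto P L = (count_upto (P `&` Q) L + count_upto (P `\` Q) L)%N.
Proof.
rewrite {1}/count_upto -(cardsID [set x : 'X_{1..n < L.+1} | `[< Q x >]]%SET).
congr addn; apply: eq_card => x; rewrite !finset.inE.
  apply/andP/asboolP => [[/asboolP Px /asboolP Qx]|[Px Qx]]; split=> //;
    exact/asboolP.
apply/andP/asboolP => [[/asboolP nQx /asboolP Px]|[Px nQx]]; split=> //;
  exact/asboolP.
Qed.

Section Counting.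
Context {d : nat}.
Implicit Types (P Q : set 'X_{1..d}) (x y z : 'X_{1..d}).

Definition upclosed P := forall x y, P x -> P (x + y)%MM.

Definition sumset P Q : set 'X_{1..d} :=
  [set z | exists x y, [/\ P x, Q y & z = (x + y)%MM]].

(** Starting the iteration from all exponents, that is from the unit ideal,
    makes [nfold P n] the exponents of the [n]-th power of a monomial ideal. *)
Definition nfold P (n : nat) : set 'X_{1..d} := iter n (sumset P) setT.

Lemma upclosed_le P x y : upclosed P -> P x -> (x <= y)%MM -> P y.
Proof. by move=> uP Px lexy; rewrite -(submK lexy) addmC; apply: uP. Qed.

Lemma upclosed_sumset P Q : upclosed Q -> upclosed (sumset P Q).
Proof.
move=> uQ x y [a [b [Pa Qb ->]]]; exists a, (b + y)%MM; split=> //.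
- exact: uQ.
- by rewrite addmA.
Qed.

Lemma upclosed_nfold P n : upclosed (nfold P n).
Proof. by elim: n => [|n IHn] //=; apply: upclosed_sumset. Qed.

Lemma nfoldD P m n x y :
  nfold P m x -> nfold P n y -> nfold P (m + n) (x + y)%MM.
Proof.
elim: m x => [|m IHm] x /=; first by rewrite add0n addmC => _ /upclosed_nfold.
move=> [a [b [Pa Pb ->]]] Py; exists a, (b + y)%MM; rewrite addmA; split=> //.
exact: IHm.
Qed.

(** Powers of an ideal decrease, whereas the members of a graded family need not. *)
Lemma nfold_decr P m n : nfold P (m + n) `<=` nfold P n.
Proof.
elim: m => [|m IHm] //= x [a [b [_ /IHm Pb ->]]].
by rewrite addmC; apply: upclosed_nfold.
Qed.

Lemma nfoldM P m n : nfold P (m * n) `<=` nfold (nfold P m) n.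
Proof.
elim: n => [|n IHn] //; rewrite mulnS /= => x.
suff split_nfold (a b : nat) y : nfold P (a + b) y ->
    exists u v, [/\ nfold P a u, nfold P b v & y = (u + v)%MM].
  move=> /split_nfold [u [v [Pu Pv ->]]].
  by exists u, v; split=> //; apply: IHn.
elim: a y => [|a IHa] y /=.
  by exists 0%MM, y; rewrite add0m.
move=> [u [v [Pu /IHa[u' [v' [Pu' Pv' ->]]] ->]]].
by exists (u + u')%MM, v'; split; [exists u, u'|by []|rewrite addmA].
Qed.

Lemma nfold_sub P Q n : P `<=` Q -> nfold P n `<=` nfold Q n.
Proof.
move=> PQ; elim: n => [|n IHn] //= x [u [v [Pu Pv ->]]].
by exists u, v; split; [apply: PQ|apply: IHn|].
Qed.

Lemma nfold_muln P n x : P x -> nfold P n (x *+ n)%MM.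
Proof.
move=> Px; elim: n => [|n IHn] //=; exists x, (x *+ n)%MM; split=> //.
exact: mulmS.
Qed.

Lemma count_upto_sub P Q L : P `<=` Q -> (count_upto P L <= count_upto Q L)%N.
Proof. by move=> PQ; apply: (@count_upto_inj _ _ _ _ _ _ id) => // x /PQ. Qed.

Lemma count_upto_shift P Q L L' a :
  (forall x, P x -> Q (x + a)%MM) -> (L + mdeg a <= L')%N ->
  (count_upto P L <= count_upto Q L')%N.
Proof.
move=> PQ leL; apply: (@count_upto_inj _ _ _ _ _ _ (fun x => (x + a)%MM)).
  move=> x Px le_x; split; first exact: PQ.
  by rewrite mdegD (leq_trans _ leL) // leq_add2r.
by move=> x y _ _ _ _ /addIm.
Qed.

Lemma lem0m x : (0 <= x)%MM.
Proof. by apply/mnm_lepP => i; rewrite mnm0E. Qed.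

Lemma mdeg_ge x i : (x i <= mdeg x)%N.
Proof. by rewrite mdegE (bigD1 i) //= leq_addr. Qed.

Lemma count_upto_le P L : (count_upto P L <= L.+1 ^ d)%N.
Proof.
have -> : (L.+1 ^ d)%N = #|{ffun 'I_d -> 'I_L.+1}| by rewrite card_ffun !card_ord.
pose g (x : 'X_{1..d < L.+1}) : {ffun 'I_d -> 'I_L.+1} :=
  [ffun i => inord (x i)].
rewrite /count_upto -(card_imset (f := g)) ?max_card // => x y /ffunP eq_xy.
apply/val_inj/mnmP => i; have := eq_xy i; rewrite !ffunE => /(congr1 val).
by rewrite /= !inordK // (leq_ltn_trans (mdeg_ge _ _)) // bmdeg.
Qed.

(** An exponent is determined by its degree together with all its coordinates
    but one, so a layer of degrees contributes one dimension less. *)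
Lemma count_upto_layer P L L' : (0 < d)%N -> (L <= L')%N ->
  (count_upto P L' <= count_upto P L + (L' - L) * L'.+1 ^ d.-1)%N.
Proof.
move=> d_gt0 leLL'.
rewrite {1}/count_upto -(cardsID [set x : 'X_{1..d < L'.+1} | (mdeg x <= L)%N]%SET).
apply: leq_add.
  pose g (x : 'X_{1..d < L'.+1}) : 'X_{1..d < L.+1} := insubd (@bm0 d L) (bmnm x).
  have gE (x : 'X_{1..d < L'.+1}) : (mdeg x <= L)%N -> bmnm (g x) = x.
    by move=> le_x; rewrite /g /insubd insubT.
  rewrite -(card_in_imset (f := g)) => [|x y].
    apply/subset_leq_card/fintype.subsetP => _ /imsetP[x + ->].
    by rewrite !finset.inE => /andP[/asboolP Px le_x]; apply/asboolP; rewrite gE.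
  rewrite !finset.inE => /andP[_ le_x] /andP[_ le_y] /(congr1 (@bmnm d L.+1)).
  by rewrite !gE // => /val_inj.
pose i0 := Ordinal d_gt0.
set S := (X in (#|X| <= _)%N).
have [leL'L|ltLL'] := leqP L' L.
  rewrite eq_card0 // => x; rewrite !finset.inE.
  by rewrite (leq_trans _ leL'L) // -ltnS bmdeg.
have [n nE] : exists n, (L' - L = n.+1)%N.
  by exists (L' - L).-1; rewrite prednK ?subn_gt0.
have -> : ((L' - L) * L'.+1 ^ d.-1)%N =
          #|{: 'I_n.+1 * {ffun 'I_d.-1 -> 'I_L'.+1}}|.
  by rewrite card_prod card_ffun !card_ord nE.
pose g (x : 'X_{1..d < L'.+1}) : 'I_n.+1 * {ffun 'I_d.-1 -> 'I_L'.+1} :=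
  (inord (mdeg x - L.+1), [ffun j => inord (x (lift i0 j))]).
rewrite -(card_in_imset (f := g)) ?max_card // => x y.
rewrite !finset.inE -!ltnNge => /andP[lt_x _] /andP[lt_y _].
move=> [/(congr1 val) eq_deg eq_xy].
have lt_n (z : 'X_{1..d < L'.+1}) : (mdeg z - L.+1 < n.+1)%N.
  by rewrite ltnS -[n]/(n.+1.-1) -nE -subnS leq_sub2r // -ltnS bmdeg.
rewrite /= !inordK // in eq_deg.
have {}eq_deg : mdeg x = mdeg y.
  by rewrite -(subnK lt_x) eq_deg subnK.
have eq_lift j : x (lift i0 j) = y (lift i0 j).
  have := congr1 (fun f : {ffun _ -> _} => val (f j)) eq_xy.
  by rewrite /= !ffunE !inordK // (leq_ltn_trans (mdeg_ge _ _)) // bmdeg.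
have eq_sum : (\sum_(i | i != i0) x i = \sum_(i | i != i0) y i)%N.
  by apply: eq_bigr => i; rewrite eq_sym => /unlift_some[j -> _].
apply/val_inj/mnmP => i; case: (unliftP i0 i) => [j -> //|->].
move: eq_deg; rewrite !mdegE (bigD1 i0) //= [in RHS](bigD1 i0) //= eq_sum.
exact: addIn.
Qed.

Lemma sub_mdeg (x : 'X_{1..d}) (n : nat) : (n <= mdeg x)%N ->
  exists x', (x' <= x)%MM /\ mdeg x' = n.
Proof.
elim: n => [|n IHn] le_n.
  by exists 0%MM; rewrite mdeg0; split=> //; apply: lem0m.
have [x' [le_x' deg_x']] := IHn (ltnW le_n).
have [i lt_i] : exists i, (x' i < x i)%N.
  apply: contrapT => /forallNP nlt; move: le_n; rewrite -deg_x' ltnNge !mdegE.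
  by case/negP; apply: leq_sum => i _; rewrite leqNgt; apply/negP.
exists (x' + U_(i))%MM; rewrite mdegD mdeg1 deg_x' addn1; split=> //.
apply/mnm_lepP => j; rewrite mnmDE mnm1E; case: eqP => [<-|_]; first by rewrite addn1.
by rewrite addn0; apply/mnm_lepP.
Qed.

(** The vector [z] is the sum of the [D] indicator vectors of the sets
    [z_i > t], for [t < D]; adding one of them to each copy of [x] stays in an
    up-set. *)
Lemma nfold_cube P D x z : upclosed P -> P x -> (forall i, (z i <= D)%N) ->
  nfold P D (x *+ D + z)%MM.
Proof.
move=> uP Px; elim: D z => [|D IHD] z le_z //=.
pose u := [multinom ((z i == D.+1) : nat) | i < d].
exists (x + u)%MM, (x *+ D + (z - u))%MM; split; first exact: uP.
  apply: IHD => i; rewrite mnmBE mnmE; have := le_z i.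
  case: eqP => [->|/eqP ne_z] le_zD; first by rewrite subn1.
  by rewrite subn0 -ltnS ltn_neqAle ne_z.
apply/mnmP => i; rewrite mulmS !mnmE.
have : ((z i == D.+1) <= z i)%N by case: eqP => [->|].
by move/subnKC => {1}<-; rewrite -!addnA; congr addn; rewrite addnCA.
Qed.

(** The cubes [D x + {0, ..., D - 1}^d] are disjoint for distinct [x]: Euclidean
    division by [D] recovers [x] and the position in the cube. *)
Lemma count_upto_cubes P D L : (0 < d)%N -> upclosed P ->
  (D ^ d * count_upto P L <= count_upto (nfold P D) (D * (L + d)))%N.
Proof.
move=> d_gt0 uP; case: D => [|D]; first by rewrite exp0n.
have -> : (D.+1 ^ d)%N = #|{ffun 'I_d -> 'I_D.+1}| by rewrite card_ffun !card_ord.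
set B := (D.+1 * (L + d))%N.
pose g (p : {ffun 'I_d -> 'I_D.+1} * 'X_{1..d < L.+1}) : 'X_{1..d < B.+1} :=
  insubd (@bm0 d B) (p.2 *+ D.+1 + [multinom p.1 i | i < d])%MM.
have gE p : bmnm (g p) = (p.2 *+ D.+1 + [multinom p.1 i | i < d])%MM.
  rewrite /g /insubd insubT //= ltnS mdegD mdegMn /B mulnDr.
  rewrite leq_add //; first by rewrite mulnC leq_mul // -ltnS bmdeg.
  rewrite mdegE; apply: (@leq_trans (\sum_(i < d) D.+1)).
    by apply: leq_sum => i _; rewrite mnmE ltnW.
  by rewrite sum_nat_const card_ord mulnC.
rewrite -cardsT /count_upto -cardsX -(card_imset (f := g)).
  apply/subset_leq_card/fintype.subsetP => _ /imsetP[p + ->].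
  rewrite !finset.inE /= => /asboolP Px; apply/asboolP; rewrite gE.
  apply: (@nfold_cube P D.+1 _ [multinom p.1 i | i < d] uP Px) => i.
  by rewrite mnmE ltnW.
move=> p q /(congr1 (@bmnm d B.+1)); rewrite !gE => /mnmP eq_pq.
have eq_i i : (p.2 i * D.+1 + p.1 i = q.2 i * D.+1 + q.1 i)%N.
  by have := eq_pq i; rewrite !mnmDE !mulmnE !mnmE.
case: p q {eq_pq} eq_i => [p x] [q y] /= eq_i; congr pair.
  apply/ffunP => i; apply/val_inj; have := congr1 (modn^~ D.+1) (eq_i i).
  by rewrite !modnMDl !modn_small.
apply/val_inj/mnmP => i; have := congr1 (divn^~ D.+1) (eq_i i).
by rewrite !divnMDl // !divn_small // !addn0.
Qed.

(** Lowering the truncation of [P] by [d] leaves room for the cubes, at the cost of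
    a boundary layer. *)
Lemma count_upto_nfold P D L : (0 < d)%N -> upclosed P ->
  (D ^ d * count_upto P L <=
     count_upto (nfold P D) (D * L) + D ^ d * (d * L.+1 ^ d.-1))%N.
Proof.
move=> d_gt0 uP; have [le_dL|lt_Ld] := leqP d L.
  apply: (@leq_trans (D ^ d * count_upto P (L - d) + D ^ d * (d * L.+1 ^ d.-1))).
    rewrite -mulnDr leq_mul // (leq_trans (count_upto_layer P d_gt0 (leq_subr d L))) //.
    by rewrite subKn.
  by rewrite leq_add2r (leq_trans (count_upto_cubes D (L - d) d_gt0 uP)) // subnK.
rewrite -[leqLHS]add0n leq_add // leq_mul // (leq_trans (count_upto_le P L)) //.
by rewrite -{1}(prednK d_gt0) expnS leq_mul.
Qed.

Lemma nfold_big P c n x : (forall x, (c <= mdeg x)%N -> P x) ->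
  (c * n <= mdeg x)%N -> nfold P n x.
Proof.
move=> bigP; elim: n x => [|n IHn] x //= le_x.
have [y [le_yx deg_y]] := @sub_mdeg x c (leq_trans (leq_pmulr c (ltn0Sn n)) le_x).
exists y, (x - y)%MM; split; first by apply: bigP; rewrite deg_y.
  by apply: IHn; rewrite -(leq_add2r (mdeg y)) -mdegD submK // deg_y -mulnSr.
by rewrite addmC submK.
Qed.

End Counting.

(** * Families of up-sets and their truncated counts *)

Section Families.
Context {d s : nat}.
Implicit Types (B : 'I_s -> set 'X_{1..d}) (A : 'I_s -> nat -> set 'X_{1..d}).
Implicit Types (nu c : 'I_s -> nat) (x y : 'X_{1..d}).

(** Closing the Minkowski sum upwards makes the sum of no sets at all equal to
    the exponents of the unit ideal, like an empty product of ideals. *)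
Definition sum_upset B : set 'X_{1..d} :=
  [set x | exists y : 'I_s -> 'X_{1..d},
     (forall i, B i (y i)) /\ (\sum_i y i <= x)%MM].

(** The exponents of a graded family of nonzero monomial ideals, the [n]-th of
    which is generated in degrees at most [C * n]. *)
Record admissible A (C : nat) : Prop := Admissible {
  adm_up : forall i n, upclosed (A i n);
  adm_0 : forall i, A i 0%N 0%MM;
  adm_D : forall i m n x y, A i m x -> A i n y -> A i (m + n)%N (x + y)%MM;
  adm_ne : forall i n, exists x, A i n x;
  adm_gen : forall i n x, A i n x ->
    exists g, [/\ A i n g, (g <= x)%MM & (mdeg g <= C * n)%N] }.

(** Both the generators and the level of truncation grow linearly in [nu], which
    makes these counts grow like [m ^ d] along [m * nu]. *)
Definition trunc_count A C nu : nat :=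
  count_upto (sum_upset (fun i => A i (nu i))) (C * \sum_i nu i)%N.

Definition power_family A (p : nat) : 'I_s -> nat -> set 'X_{1..d} :=
  fun i n => nfold (A i p) n.

Lemma lem_addm x y x' y' : (x <= x')%MM -> (y <= y')%MM ->
  (x + y <= x' + y')%MM.
Proof.
move=> /mnm_lepP lex /mnm_lepP ley; apply/mnm_lepP => i.
by rewrite !mnmDE leq_add.
Qed.

Lemma upclosed_sum_upset B : upclosed (sum_upset B).
Proof.
move=> x z [y [By le_x]]; exists y; split=> //.
exact: lepm_trans le_x (lem_addr _ _).
Qed.

Lemma sum_upset_sub B B' : (forall i, B i `<=` B' i) -> sum_upset B `<=` sum_upset B'.
Proof. by move=> sB x [y [By le_x]]; exists y; split=> // i; apply: sB. Qed.

Lemma sum_upsetD B B' B'' x x' :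
  (forall i y y', B i y -> B' i y' -> B'' i (y + y')%MM) ->
  sum_upset B x -> sum_upset B' x' -> sum_upset B'' (x + x')%MM.
Proof.
move=> BD [y [By le_x]] [y' [By' le_x']].
exists (fun i => y i + y' i)%MM; split=> [i|]; first exact: BD.
by rewrite big_split lem_addm.
Qed.

Lemma mem_sum_upset B (y : 'I_s -> 'X_{1..d}) :
  (forall i, B i (y i)) -> sum_upset B (\sum_i y i)%MM.
Proof. by move=> By; exists y; split=> //; apply: lepm_refl. Qed.

Lemma nfold_sum_upset B n :
  nfold (sum_upset B) n `<=` sum_upset (fun i => nfold (B i) n).
Proof.
elim: n => [|n IHn] /= x => [_|[u [v [Bu /IHn Bv ->]]]].
  by exists (fun=> 0%MM); split=> //; rewrite big1 //; apply: lem0m.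
by apply: sum_upsetD Bu Bv => i y y' By By'; exists y, y'.
Qed.

Lemma mdeg_sum_le (C : nat) nu (y : 'I_s -> 'X_{1..d}) :
  (forall i, (mdeg (y i) <= C * nu i)%N) ->
  (mdeg (\sum_i y i)%MM <= C * \sum_i nu i)%N.
Proof.
by move=> le_y; rewrite mdeg_sum big_distrr leq_sum.
Qed.

Section Admissible.
Variables (A : 'I_s -> nat -> set 'X_{1..d}) (C : nat).
Hypothesis admA : admissible A C.

Lemma adm_small i n : exists g, A i n g /\ (mdeg g <= C * n)%N.
Proof.
have [x /(adm_gen admA)[g [Ag _ le_g]]] := adm_ne admA i n.
by exists g.
Qed.

Lemma adm_small_fun nu : exists y : 'I_s -> 'X_{1..d},
  forall i, A i (nu i) (y i) /\ (mdeg (y i) <= C * nu i)%N.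
Proof.
by have [y yP] := boolp.choice (fun i => adm_small i (nu i)); exists y.
Qed.

Lemma adm_0T i : A i 0%N = setT.
Proof.
apply/seteqP; split=> // x _; rewrite -[x]add0m.
exact: (adm_up admA) (adm_0 admA i).
Qed.

Lemma nfold_adm i a n : nfold (A i a) n `<=` A i (a * n)%N.
Proof.
elim: n => [|n IHn] x; first by rewrite muln0 adm_0T.
by rewrite mulnS => -[u [v [Au /IHn Av ->]]]; apply: (adm_D admA).
Qed.

(** Adding one element of small degree of the missing members is injective and
    respects the truncation. *)
Lemma trunc_count_mono nu nu' : (forall i, (nu i <= nu' i)%N) ->
  (trunc_count A C nu <= trunc_count A C nu')%N.
Proof.
move=> le_nu; have [y yP] := adm_small_fun (fun i => nu' i - nu i)%N.
apply: (count_upto_shift (a := (\sum_i y i)%MM)) => [x Ax|].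
  pose B i := A i (nu' i - nu i)%N; have By : sum_upset B (\sum_i y i)%MM.
    by apply: mem_sum_upset => i; case: (yP i).
  rewrite addmC; apply: sum_upsetD By Ax => i u v Au Av.
  by have := adm_D admA Au Av; rewrite subnK.
have le_y := mdeg_sum_le (fun i => proj2 (yP i)).
apply: leq_trans (leq_add (leqnn _) le_y) _.
rewrite -mulnDr leq_mul // -big_split /= leq_sum // => i _.
by rewrite subnKC.
Qed.

Lemma power_family_adm p : admissible (power_family A p) (C * p).
Proof.
split=> [i n|i|i m n x y|i n|i n].
- exact: upclosed_nfold.
- by [].
- exact: nfoldD.
- have [x Ax] := adm_ne admA i p.
  by exists (x *+ n)%MM; exact: (nfold_muln n Ax).
elim: n => [|n IHn] x /=.
  by move=> _; exists 0%MM; rewrite mdeg0; split=> //; apply: lem0m.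
move=> [u [v [/(adm_gen admA)[g [Ag le_g le_gC]] /IHn[g' [Ag' le_g' le_gC']] ->]]].
exists (g + g')%MM; split; [by exists g, g'|exact: lem_addm|].
by rewrite mdegD mulnS leq_add.
Qed.

Lemma trunc_count_power_le p nu :
  (trunc_count (power_family A p) (C * p) nu <= trunc_count A C (fun i => p * nu i))%N.
Proof.
rewrite /trunc_count -big_distrr /= mulnA; apply/count_upto_sub/sum_upset_sub => i.
exact: nfold_adm.
Qed.

Lemma trunc_count_cubes D nu : (0 < d)%N ->
  (D ^ d * trunc_count A C nu <= trunc_count A C (fun i => D * nu i) +
     D ^ d * (d * (C * \sum_i nu i).+1 ^ d.-1))%N.
Proof.
move=> d_gt0; apply: leq_trans (count_upto_nfold D _ d_gt0 (@upclosed_sum_upset _)) _.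
rewrite leq_add2r /trunc_count -big_distrr /= mulnCA; apply: count_upto_sub.
apply: subset_trans (@nfold_sum_upset _ _) (sum_upset_sub _) => i.
by rewrite mulnC; apply: nfold_adm.
Qed.

(** When every nonzero [nu i] divides [N], the [N * t]-fold sum of the
    [q * nu i]-th member can be regrouped into [nu i] blocks, each of them inside
    the member of index [N * q * t]. This compares the sums of elements of one
    member, which are all that the powers of the [p]-th member see, with the
    members of index proportional to [nu]. *)
Lemma trunc_count_power_cubes N q t m nu : (0 < d)%N ->
  (forall i, (0 < nu i)%N -> (nu i %| N)%N) ->
  ((N * t * m) ^ d * trunc_count A C (fun i => q * nu i) <=
     trunc_count (power_family A (N * q * t)) (C * (N * q * t)) (fun i => m * nu i) +
     (N * t * m) ^ d * (d * (C * \sum_i q * nu i).+1 ^ d.-1))%N.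
Proof.
move=> d_gt0 dvdN.
apply: leq_trans (count_upto_nfold _ _ d_gt0 (@upclosed_sum_upset _)) _.
rewrite leq_add2r /trunc_count -!big_distrr /=.
rewrite (_ : (N * t * m * _ = C * (N * q * t) * (m * \sum_i nu i))%N); last by ring.
apply: count_upto_sub.
apply: subset_trans (@nfold_sum_upset _ _) (sum_upset_sub _) => i.
rewrite /power_family; have [->|nu_gt0] := posnP (nu i).
  by rewrite [in X in _ `<=` X]muln0.
have /dvdnP[u NE] := dvdN i nu_gt0.
rewrite (_ : (N * t * m = (u * t) * (m * nu i))%N); last by rewrite NE; ring.
apply: subset_trans (@nfoldM _ _ _ _) (nfold_sub _).
apply: subset_trans (@nfold_adm _ _ _) _.
by rewrite (_ : (q * nu i * (u * t) = N * q * t)%N) // NE; ring.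
Qed.

Lemma trunc_count_power_mono p p' nu : (p <= p')%N ->
  (trunc_count (power_family A p) (C * p) nu <=
   trunc_count (power_family A p') (C * p') nu)%N.
Proof.
move=> le_p; have [y yP] := adm_small_fun (fun=> p' - p)%N.
apply: (count_upto_shift (a := (\sum_i y i *+ nu i)%MM)) => [x Ax|].
  pose B i := nfold (A i (p' - p)%N) (nu i).
  apply: sum_upsetD Ax (mem_sum_upset (B := B) _); last first.
    by move=> i; apply/nfold_muln/(proj1 (yP i)).
  rewrite /power_family /B => i u v; elim: (nu i) u v => [|n IHn] u v //=.
  move=> [a [b [Aa Ab ->]]] [a' [b' [Aa' Ab' ->]]].
  exists (a + a')%MM, (b + b')%MM; split; [|exact: IHn|].
    by rewrite -(subnKC le_p); apply: (adm_D admA).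
  by rewrite -!addmA; congr mnm_add; rewrite addmA [(b + a')%MM]addmC addmA.
have le_y i : (mdeg (y i *+ nu i)%MM <= C * (p' - p) * nu i)%N.
  by rewrite mdegMn leq_mul // (proj2 (yP i)).
apply: leq_trans (leq_add (leqnn _) (mdeg_sum_le le_y)) _.
by rewrite -mulnDl -mulnDr subnKC.
Qed.

Lemma trunc_count_power_layer p nu c : (0 < d)%N ->
  (trunc_count (power_family A p) (C * p) (fun i => nu i + c i) <=
   trunc_count (power_family A p) (C * p) nu +
     (C * p * \sum_i c i) * (C * p * (\sum_i nu i + \sum_i c i)).+1 ^ d.-1)%N.
Proof.
move=> d_gt0; rewrite /trunc_count big_split /=.
set L := (C * p * \sum_i nu i)%N; set L' := (C * p * (_ + _))%N.
have -> : (C * p * \sum_i c i = L' - L)%N by rewrite /L /L' mulnDr addKn.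
apply: (@leq_trans (count_upto (sum_upset (fun i => power_family A p i (nu i))) L')).
  by apply/count_upto_sub/sum_upset_sub => i; rewrite addnC; apply: nfold_decr.
by apply: count_upto_layer; rewrite // leq_mul // leq_addr.
Qed.

End Admissible.
End Families.

(** * Volumes as limits of truncated counts *)

Section Limits.
Context {R : realType}.

Lemma cvgn_le (u : nat -> R) (l : R) :
  (forall eps : R, 0 < eps ->
     exists N : nat, forall n, (N <= n)%N -> `|l - u n| <= eps) ->
  u @ \oo --> l.
Proof.
move=> uP; apply/cvgrPdist_le => eps eps_gt0; have [N NP] := uP eps eps_gt0.
by exists N.
Qed.

Lemma natr_ge (x : R) : exists N : nat, (0 < N)%N /\ x <= N%:R.
Proof.
exists (Num.truncn x).+1; split=> //; exact/ltW/truncnS_gt.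
Qed.

Lemma expn_sub_le (p q e : nat) : (q <= p)%N ->
  (p ^ e <= q ^ e + e * (p - q) * p ^ e.-1)%N.
Proof.
move=> le_qp; elim: e => [|e IHe]; first by rewrite !expn0.
rewrite expnS /=.
apply: (@leq_trans (p * (q ^ e + e * (p - q) * p ^ e.-1))); first by rewrite leq_mul.
rewrite mulnDr; have -> : (p * (e * (p - q) * p ^ e.-1) = e * (p - q) * p ^ e)%N.
  by case: (e) => [|e']; rewrite ?muln0 //= expnS mulnCA.
rewrite -{1}(subnKC le_qp) mulnDl -expnS -addnA leq_add2l.
rewrite (mulSn e) mulnDl leq_add2r leq_mul //.
by case: (e) => // e'; rewrite leq_exp2r.
Qed.

(** A form of Fekete's lemma: a nondecreasing sequence bounded above by
    [v p ^ e], up to lower order, and almost reaching this bound along the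
    multiples of some [Q], stays close to it in between, since consecutive
    multiples of [Q] have ratio tending to 1. *)
Lemma growth_cvg (e : nat) (b : nat -> R) (v K : R) :
  (forall p p', (p <= p')%N -> b p <= b p') ->
  (forall p, (0 < p)%N -> b p / p%:R ^+ e <= v + K / p%:R) ->
  (forall eps, 0 < eps -> exists Q, (0 < Q)%N /\
     forall t, (Q * t)%:R ^+ e * (v - eps) <= b (Q * t)%N) ->
  (fun p => b p / p%:R ^+ e) @ \oo --> v.
Proof.
move=> b_mono b_up b_low; apply: cvgn_le => eps eps_gt0.
have eps2_gt0 : 0 < eps / 2 by rewrite divr_gt0.
have [Q [Q_gt0 QP]] := b_low _ eps2_gt0.
have [N1 [N1_gt0 N1P]] := natr_ge (K / eps).
have [N2 [N2_gt0 N2P]] := natr_ge ((e * Q)%:R * `|v| / (eps / 2)).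
exists (maxn N1 N2) => p; rewrite geq_max => /andP[le1 le2].
have p_gt0 : (0 < p)%N by apply: leq_trans le1.
have pR_gt0 : 0 < p%:R :> R by rewrite ltr0n.
have up : b p / p%:R ^+ e <= v + eps.
  apply: le_trans (b_up p p_gt0) _; rewrite lerD2l ler_pdivrMr //.
  rewrite mulrC -ler_pdivrMr //; apply: le_trans N1P _.
  by rewrite ler_nat.
have low : v - eps <= b p / p%:R ^+ e.
  rewrite ler_pdivlMr ?exprn_gt0 //.
  pose q := (Q * (p %/ Q))%N.
  have le_qp : (q <= p)%N by rewrite /q mulnC leq_trunc_div.
  apply: le_trans _ (b_mono _ _ le_qp); apply: le_trans _ (QP (p %/ Q)%N); rewrite -/q.
  have lt_pqQ : (p - q <= Q)%N.
    by rewrite {1}(divn_eq p Q) /q mulnC addKn ltnW // ltn_pmod.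
  have le_exp : p%:R ^+ e <= q%:R ^+ e + (e * Q)%:R * p%:R ^+ e.-1 :> R.
    rewrite -!natrX -natrM -natrD ler_nat.
    apply: leq_trans (expn_sub_le e le_qp) _.
    by rewrite leq_add2l !leq_mul.
  have ge_exp : q%:R ^+ e <= p%:R ^+ e :> R.
    by rewrite lerXn2r ?nnegrE ?ler0n // ler_nat.
  have small : (e * Q)%:R * p%:R ^+ e.-1 * `|v| <= eps / 2 * p%:R ^+ e.
    case: (e) N2P => [_|e' N2P]; first by rewrite mul0n !mul0r mulr_ge0 ?ltW ?exprn_gt0.
    rewrite /= exprS mulrA mulrAC ler_wpM2r ?exprn_ge0 ?ler0n //.
    rewrite -ler_pdivrMl // mulrC; apply: le_trans N2P _.
    by rewrite ler_nat.
  have [w_le0|w_gt0] := leP (v - eps / 2) 0.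
    apply: (@le_trans _ _ ((v - eps / 2) * p%:R ^+ e)).
      by rewrite ler_wpM2r ?exprn_ge0 ?ler0n //; lra.
    by rewrite mulrC ler_wnM2r.
  have wv : v - eps / 2 <= `|v| by have := ler_norm v; lra.
  have Pe : 0 <= (e * Q)%:R * p%:R ^+ e.-1 :> R by rewrite mulr_ge0 ?exprn_ge0 ?ler0n.
  nra.
rewrite distrC ler_norml; apply/andP; split; lra.
Qed.

End Limits.

Section Volumes.
Context {R : realType} {d s : nat}.
Hypothesis d_gt0 : (0 < d)%N.
Implicit Types (A : 'I_s -> nat -> set 'X_{1..d}) (nu c : 'I_s -> nat).

Definition vol A C nu : R :=
  lim ((fun m : nat =>
          (trunc_count A C (fun i => m * nu i)%N)%:R / m%:R ^+ d : R) @ \oo).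

Lemma trunc_count_ext A C nu nu' :
  nu =1 nu' -> trunc_count A C nu = trunc_count A C nu'.
Proof. by move=> /funext ->. Qed.

Lemma layer_le (C S q : nat) : (0 < q)%N ->
  (d * (C * (q * S)).+1 ^ d.-1)%:R <= (d * (C * S).+1 ^ d.-1)%:R * q%:R ^+ d.-1 :> R.
Proof.
move=> q_gt0; rewrite -natrX -natrM ler_nat -mulnA leq_mul // -expnMn.
case: d.-1 => [|e]; first by [].
by rewrite leq_exp2r // mulSn mulnCA mulnC -addn1 addnC leq_add2r.
Qed.

Lemma natr_expS (q : nat) : q%:R ^+ d = q%:R * q%:R ^+ d.-1 :> R.
Proof. by rewrite -exprS prednK. Qed.

Section Admissible.
Variables (A : 'I_s -> nat -> set 'X_{1..d}) (C : nat).
Hypothesis admA : admissible A C.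

Let K nu : R := (d * (C * \sum_i nu i).+1 ^ d.-1)%:R.

(** The limit is the supremum of the counts corrected by their boundary layers:
    by the cube argument, a corrected count at [q] bounds the counts at all
    multiples of [q] from below. *)
Lemma trunc_count_cvg_ex nu : exists v : R,
  (fun m : nat => (trunc_count A C (fun i => m * nu i)%N)%:R / m%:R ^+ d : R) @ \oo
    --> v.
Proof.
pose a (q : nat) : R :=
  (trunc_count A C (fun i => q * nu i)%N)%:R / q%:R ^+ d - K nu / q%:R.
pose E : set R := [set a q | q in [set q : nat | (0 < q)%N]].
pose M := ((C * \sum_i nu i).+1 ^ d)%:R : R.
have ubM : ubound E M.
  move=> _ [q /= q_gt0 <-]; rewrite /a lerBlDr.
  apply: (@le_trans _ _ M); last by rewrite lerDl divr_ge0 ?ler0n.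
  rewrite ler_pdivrMr ?exprn_gt0 ?ltr0n // /M -natrX -natrM ler_nat -expnMn.
  apply: leq_trans (count_upto_le _ _) _; rewrite leq_exp2r // -big_distrr /=.
  by rewrite mulSn mulnCA mulnC -addn1 addnC leq_add2r.
have supE : has_sup E by split; [exists (a 1%N), 1%N|exists M].
exists (sup E); apply: (@growth_cvg _ d _ _ (K nu)).
- move=> p p' le_p; rewrite ler_nat; apply: trunc_count_mono => // i.
  by rewrite leq_mul.
- move=> p p_gt0; rewrite -lerBlDr; apply: ub_le_sup; first by exists M.
  by exists p.
move=> eps eps_gt0; have [_ [q /= q_gt0 <-] lt_q] := sup_adherent eps_gt0 supE.
exists q; split=> // t; rewrite natrM exprMn.
have qR_gt0 : 0 < q%:R :> R by rewrite ltr0n.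
have cube := trunc_count_cubes admA t (fun i => q * nu i)%N d_gt0.
apply: (@le_trans _ _ (t%:R ^+ d * (q%:R ^+ d * a q))).
  rewrite [q%:R ^+ d * t%:R ^+ d]mulrC -mulrA.
  do 2 (apply: ler_wpM2l; first by rewrite exprn_ge0 ?ler0n).
  exact: ltW.
have -> : q%:R ^+ d * a q =
    (trunc_count A C (fun i => q * nu i)%N)%:R - K nu * q%:R ^+ d.-1.
  rewrite /a mulrBr mulrCA divff ?mulr1 ?expf_neq0 ?gt_eqF //.
  by rewrite natr_expS mulrCA; congr (_ - _); field; rewrite gt_eqF.
rewrite mulrBr lerBlDr.
move: cube; rewrite -(ler_nat R) natrD !natrM natrX => /le_trans; apply.
rewrite lerD //.
  rewrite ler_nat (@trunc_count_ext A C _ (fun i => q * t * nu i)%N) // => i.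
  by rewrite mulnA (mulnC t).
rewrite ler_wpM2l ?exprn_ge0 ?ler0n // -natrM.
apply: le_trans _ (layer_le C (\sum_i nu i) q_gt0).
by rewrite -big_distrr.
Qed.

Lemma vol_cvg nu :
  (fun m : nat => (trunc_count A C (fun i => m * nu i)%N)%:R / m%:R ^+ d : R) @ \oo
    --> vol A C nu.
Proof. by have [v vP] := trunc_count_cvg_ex nu; rewrite /vol (cvg_lim _ vP). Qed.

Lemma cvg_natV : (fun m : nat => m%:R^-1 : R) @ \oo --> 0.
Proof.
apply: cvgn_le => eps eps_gt0; have [N [N_gt0 NP]] := @natr_ge R eps^-1.
exists N => n le_Nn; have n_gt0 : (0 < n)%N by apply: leq_trans le_Nn.
rewrite sub0r normrN ger0_norm ?invr_ge0 ?ler0n // -[eps]invrK.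
rewrite lef_pV2 ?posrE ?invr_gt0 ?ltr0n //.
by apply: le_trans NP _; rewrite ler_nat.
Qed.

Lemma volM (D : nat) nu : (0 < D)%N ->
  vol A C (fun i => D * nu i)%N = D%:R ^+ d * vol A C nu.
Proof.
move=> D_gt0; apply: (@cvg_lim R) => //.
have subseq : (fun m : nat => (m * D)%N) @ \oo --> \oo.
  by apply: cvg_mulnr.
have := cvg_comp _ _ subseq (@vol_cvg nu).
move=> /(cvgZr (k := D%:R ^+ d)).
apply: cvg_trans; apply: near_eq_cvg; near=> m => /=.
have m_gt0 : (0 < m)%N by near: m; exists 1%N.
rewrite /= (@trunc_count_ext A C _ (fun i => m * D * nu i)%N) => [|i]; last first.
  by rewrite mulnA.
rewrite natrM exprMn /GRing.scale /=; field; rewrite !expf_neq0 ?pnatr_eq0 -?lt0n //.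
Unshelve. all: by end_near. Qed.

End Admissible.

Arguments vol_cvg {A C} admA nu.

Section Powers.
Variables (A : 'I_s -> nat -> set 'X_{1..d}) (C : nat).
Hypothesis admA : admissible A C.

Let K nu : R := (d * (C * \sum_i nu i).+1 ^ d.-1)%:R.

(** The powers of the [p]-th member of a graded family are contained in the
    family, whence the upper bound; a fixed member of large index [q] fills almost
    the whole volume, and for large [p] the [p]-th member contains enough sums of
    elements of it, whence the lower bound. *)
Lemma vol_power_cvg nu :
  (fun p : nat => vol (power_family A p) (C * p) nu / p%:R ^+ d) @ \oo --> vol A C nu.
Proof.
apply: (@growth_cvg _ d _ _ 0).
- move=> p p' le_p; apply: ler_cvg_to (vol_cvg (power_family_adm admA p) nu)
    (vol_cvg (power_family_adm admA p') nu) _.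
  near=> m; rewrite ler_wpM2r ?invr_ge0 ?exprn_ge0 ?ler0n // ler_nat.
  exact: trunc_count_power_mono.
- move=> p p_gt0; rewrite mul0r addr0 ler_pdivrMr ?exprn_gt0 ?ltr0n // mulrC -volM //.
  apply: ler_cvg_to (vol_cvg (power_family_adm admA p) nu) (vol_cvg admA _) _.
  near=> m; rewrite ler_wpM2r ?invr_ge0 ?exprn_ge0 ?ler0n // ler_nat.
  apply: leq_trans (trunc_count_power_le admA _ _) _.
  rewrite (@trunc_count_ext A C _ (fun i => m * (p * nu i))%N) // => i.
  by rewrite mulnCA.
move=> eps eps_gt0.
pose a (q : nat) : R :=
  (trunc_count A C (fun i => q * nu i)%N)%:R / q%:R ^+ d - K nu / q%:R.
have a_cvg : a @ \oo --> vol A C nu.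
  rewrite -[vol _ _ _]subr0 -[X in _ - X](mulr0 (K nu)).
  apply: cvgB; first exact: (vol_cvg admA).
  by apply: cvgMl_tmp; apply: cvg_natV.
have [q [q_gt0 lt_q]] : exists q, (0 < q)%N /\ vol A C nu - eps <= a q.
  move/cvgrPdist_le : a_cvg => /(_ eps eps_gt0)[N _ NP].
  exists N.+1; split=> //; have := NP N.+1 (leqnSn N).
  by rewrite /= ler_norml => /andP[_]; lra.
pose N := (\prod_i maxn 1 (nu i))%N.
have N_gt0 : (0 < N)%N by rewrite prodn_gt0 // => i; rewrite leq_maxl.
have dvdN i : (0 < nu i)%N -> (nu i %| N)%N.
  by move=> nu_gt0; rewrite /N (bigD1 i) //= dvdn_mulr //; move/maxn_idPr: nu_gt0 => ->.
exists (N * q)%N; rewrite muln_gt0 N_gt0 q_gt0; split=> // t.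
have cube m := trunc_count_power_cubes admA q t m d_gt0 dvdN.
have qR_gt0 : 0 < q%:R :> R by rewrite ltr0n.
apply: (@le_trans _ _ ((N * t)%:R ^+ d * (q%:R ^+ d * a q))).
  rewrite mulrA -exprMn -natrM (_ : N * t * q = N * q * t)%N; last by ring.
  by apply: ler_wpM2l; rewrite ?exprn_ge0 ?ler0n.
have -> : q%:R ^+ d * a q =
    (trunc_count A C (fun i => q * nu i)%N)%:R - K nu * q%:R ^+ d.-1.
  rewrite /a mulrBr mulrCA divff ?mulr1 ?expf_neq0 ?gt_eqF //.
  by rewrite natr_expS mulrCA; congr (_ - _); field; rewrite gt_eqF.
apply: ler_cvg_to (cvg_cst _) (vol_cvg (power_family_adm admA (N * q * t)) nu) _.
near=> m; have m_gt0 : (0 < m)%N by near: m; exists 1%N.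
rewrite ler_pdivlMr ?exprn_gt0 ?ltr0n // mulrAC -exprMn -natrM.
rewrite mulrBr lerBlDr.
have {}cube := cube m; rewrite -(ler_nat R) in cube.
apply: le_trans.
  by rewrite -natrX -natrM; exact: cube.
rewrite natrD lerD // natrM natrX ler_wpM2l ?exprn_ge0 ?ler0n //.
apply: le_trans _ (layer_le C (\sum_i nu i) q_gt0).
by rewrite -big_distrr.
Unshelve. all: by end_near. Qed.

(** Shifting the argument by a constant vector changes the counts by a boundary
    layer. In this way the values at all [nu], including those with zero entries,
    are reached from the region where counts are given by a polynomial. *)
Lemma vol_power_shift p nu c :
  (fun m : nat => (trunc_count (power_family A p) (C * p) (fun i => m * nu i + c i)%N)%:R
                    / m%:R ^+ d : R) @ \oo --> vol (power_family A p) (C * p) nu.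
Proof.
pose S := (\sum_i nu i)%N; pose S' := (\sum_i c i)%N.
pose K' : R := (C * p * S' * (C * p * (S + S')).+1 ^ d.-1)%:R.
apply: (squeeze_cvgr
  (f := fun m =>
     (trunc_count (power_family A p) (C * p) (fun i => m * nu i)%N)%:R / m%:R ^+ d)
  (h := fun m =>
     (trunc_count (power_family A p) (C * p) (fun i => m * nu i)%N)%:R / m%:R ^+ d
       + K' / m%:R)); last 2 first.
- exact: (vol_cvg (power_family_adm admA p)).
- rewrite -[vol _ _ _]addr0 -[X in _ + X](mulr0 K').
  apply: cvgD; first exact: (vol_cvg (power_family_adm admA p)).
  by apply: cvgMl_tmp; apply: cvg_natV.
near=> m; have m_gt0 : (0 < m)%N by near: m; exists 1%N.
have mR_gt0 : 0 < m%:R :> R by rewrite ltr0n.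
apply/andP; split.
  rewrite ler_wpM2r ?invr_ge0 ?exprn_ge0 ?ler0n // ler_nat.
  by apply: (trunc_count_mono (power_family_adm admA p)) => i; rewrite leq_addr.
rewrite ler_pdivrMr ?exprn_gt0 // mulrDl divfK ?expf_neq0 ?gt_eqF //.
rewrite natr_expS mulrA divfK ?gt_eqF // -natrX -natrM -natrD ler_nat.
apply: leq_trans (trunc_count_power_layer A C p (fun i => m * nu i)%N c d_gt0) _.
rewrite leq_add2l -[leqRHS]mulnA leq_mul // -expnMn.
case: (d.-1) => [|e]; first by [].
rewrite leq_exp2r // mulSn.
apply: (@leq_trans (C * p * (m * (S + S'))).+1).
  by rewrite ltnS leq_mul // mulnDr -big_distrr leq_add2l leq_pmull.
by rewrite (mulnC m) mulnA -addn1 addnC leq_add2r.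
Unshelve. all: by end_near. Qed.

End Powers.
End Volumes.

(** * Polynomial functions on lattice points *)

Section PolynomialFunctions.
Context {R : realType} {s : nat}.
Implicit Types (f g : ('I_s -> nat) -> R) (nu c : 'I_s -> nat) (D : nat).

(** Column [j] holds the coefficients of the Lagrange polynomial attached to
    the node [j] among [0, ..., D]. *)
Definition interp_weight D : 'M[R]_D.+1 := invmx (\matrix_(j, b) (j%:R ^+ b)).

Lemma interp_weightP D (a b : 'I_D.+1) :
  \sum_j interp_weight D a j * j%:R ^+ b = (a == b)%:R.
Proof.
set V : 'M[R]_D.+1 := \matrix_(j, b) (j%:R ^+ b).
have unitV : V \in unitmx.
  rewrite -unitmx_tr unitmxE.
  have -> : V^T = Vandermonde D.+1 (\row_j j%:R).
    by apply/matrixP => i j; rewrite !mxE.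
  rewrite det_Vandermonde unitfE; apply/prodf_neq0 => i _; apply/prodf_neq0 => j lt_ij.
  by rewrite !mxE subr_eq0 eqr_nat gtn_eqF.
have := congr1 (fun M : 'M_D.+1 => M a b) (mulVmx unitV).
by rewrite !mxE => <-; apply: eq_bigr => j _; rewrite [V j b]mxE.
Qed.

Lemma interp_weight_poly D (p : {poly R}) (a : 'I_D.+1) : (size p <= D.+1)%N ->
  \sum_j interp_weight D a j * p.[j%:R] = p`_a.
Proof.
move=> sz_p; under eq_bigr do rewrite (horner_coef_wide _ sz_p) mulr_sumr.
rewrite exchange_big /= (bigD1 a) //= [X in _ + X]big1 ?addr0.
  under eq_bigr do rewrite mulrCA.
  by rewrite -mulr_sumr interp_weightP eqxx mulr1.
move=> b ne_b; under eq_bigr do rewrite mulrCA.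
by rewrite -mulr_sumr interp_weightP eq_sym (negPf ne_b) mulr0.
Qed.

Definition mono (alpha nu : 'I_s -> nat) : R := \prod_i (nu i)%:R ^+ alpha i.

(** The coefficient of the monomial [alpha] in the polynomial of degree at most
    [D] in each variable that interpolates [f] on [{0, ..., D}^s]. As a linear
    combination of values, it is defined for every function and continuous. *)
Definition coef D f (alpha : {ffun 'I_s -> 'I_D.+1}) : R :=
  \sum_(pt : {ffun 'I_s -> 'I_D.+1})
     (\prod_i interp_weight D (alpha i) (pt i)) * f (fun i => pt i).

Definition is_poly D f : Prop :=
  forall nu, f nu = \sum_(alpha : {ffun 'I_s -> 'I_D.+1})
                       coef f alpha * mono (fun i => alpha i) nu.

Lemma coef_product D (p : 'I_s -> {poly R}) (alpha : {ffun 'I_s -> 'I_D.+1}) :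
  (forall i, (size (p i) <= D.+1)%N) ->
  coef (fun nu => \prod_i (p i).[(nu i)%:R]) alpha = \prod_i (p i)`_(alpha i).
Proof.
move=> sz_p; rewrite /coef; under [RHS]eq_bigr do rewrite -interp_weight_poly //.
rewrite bigA_distr_bigA; apply: eq_bigr => pt _.
by rewrite -big_split.
Qed.

Lemma is_poly_product D (p : 'I_s -> {poly R}) : (forall i, (size (p i) <= D.+1)%N) ->
  is_poly D (fun nu => \prod_i (p i).[(nu i)%:R]).
Proof.
move=> sz_p nu; under [RHS]eq_bigr do rewrite coef_product // -big_split /=.
under [LHS]eq_bigr do rewrite (horner_coef_wide _ (sz_p _)).
by rewrite bigA_distr_bigA.
Qed.

Lemma monoE alpha : mono alpha = fun nu => \prod_i ('X^(alpha i)).[(nu i)%:R].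
Proof. by apply/funext => nu; apply: eq_bigr => i _; rewrite hornerXn. Qed.

Lemma coef_mono D (alpha beta : {ffun 'I_s -> 'I_D.+1}) :
  coef (mono (fun i => beta i)) alpha = (alpha == beta)%:R.
Proof.
rewrite monoE coef_product => [|i]; last by rewrite size_polyXn.
under eq_bigr do rewrite coefXn.
have [->|/eqP ne] := eqVneq alpha beta; first by rewrite big1 // => i _; rewrite eqxx.
have [i /eqP ne_i] : exists i, alpha i <> beta i.
  by apply: contra_notP ne => /forallNP eq_ab; apply/ffunP => i; apply: contrapT.
by rewrite (bigD1 i) //= (inj_eq val_inj) (negPf ne_i) mul0r.
Qed.

Lemma is_poly_mono D (alpha : 'I_s -> nat) : (forall i, (alpha i <= D)%N) ->
  is_poly D (mono alpha).
Proof.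
by move=> le_a; rewrite monoE; apply: is_poly_product => i; rewrite size_polyXn ltnS.
Qed.

Lemma coef_sum D (I : Type) (r : seq I) (c : I -> R) (F : I -> ('I_s -> nat) -> R)
    (alpha : {ffun 'I_s -> 'I_D.+1}) :
  coef (fun nu => \sum_(t <- r) c t * F t nu) alpha =
    \sum_(t <- r) c t * coef (F t) alpha.
Proof.
rewrite /coef; under eq_bigr do rewrite mulr_sumr.
rewrite exchange_big /=; apply: eq_bigr => t _; rewrite mulr_sumr.
by apply: eq_bigr => pt _; rewrite mulrCA.
Qed.

Lemma is_poly_sum D (I : Type) (r : seq I) (c : I -> R) (F : I -> ('I_s -> nat) -> R) :
  (forall t, c t != 0 -> is_poly D (F t)) ->
  is_poly D (fun nu => \sum_(t <- r) c t * F t nu).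
Proof.
move=> polF nu; under [RHS]eq_bigr do rewrite coef_sum mulr_suml.
rewrite exchange_big /=; apply: eq_bigr => t _.
under eq_bigr do rewrite -mulrA.
rewrite -mulr_sumr; have [->|nz_c] := eqVneq (c t) 0; first by rewrite !mul0r.
by rewrite -polF.
Qed.

Lemma coef_scale D (c : R) f (alpha : {ffun 'I_s -> 'I_D.+1}) :
  coef (fun nu => c * f nu) alpha = c * coef f alpha.
Proof. by rewrite /coef mulr_sumr; apply: eq_bigr => pt _; rewrite mulrCA. Qed.

Lemma is_polyZ D f (c : R) : is_poly D f -> is_poly D (fun nu => f nu * c).
Proof.
move=> polf nu; rewrite polf mulr_suml; apply: eq_bigr => alpha _.
have -> : (fun nu => f nu * c) = (fun nu => c * f nu).
  by apply/funext => nu'; rewrite mulrC.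
by rewrite coef_scale mulrAC [c * _]mulrC.
Qed.

Lemma coefB D f g (alpha : {ffun 'I_s -> 'I_D.+1}) :
  coef (fun nu => f nu - g nu) alpha = coef f alpha - coef g alpha.
Proof. by rewrite /coef -sumrB; apply: eq_bigr => pt _; rewrite mulrBr. Qed.

Lemma is_polyB D f g : is_poly D f -> is_poly D g -> is_poly D (fun nu => f nu - g nu).
Proof.
move=> polf polg nu; rewrite polf polg -sumrB.
by apply: eq_bigr => alpha _; rewrite coefB mulrBl.
Qed.

Lemma cvg_sum_fin (I : finType) (u : I -> nat -> R) (l : I -> R) :
  (forall i, u i @ \oo --> l i) -> (fun m => \sum_i u i m) @ \oo --> \sum_i l i.
Proof.
move=> u_cvg; elim: (index_enum I) => [|i r IHr].
  by under eq_fun do rewrite big_nil; rewrite big_nil; apply: cvg_cst.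
under eq_fun do rewrite big_cons.
by rewrite big_cons; apply: cvgD.
Qed.

Lemma coef_cvg D (F : nat -> ('I_s -> nat) -> R) f (alpha : {ffun 'I_s -> 'I_D.+1}) :
  (forall nu, (fun m => F m nu) @ \oo --> f nu) ->
  (fun m => coef (F m) alpha) @ \oo --> coef f alpha.
Proof.
by move=> F_cvg; apply: cvg_sum_fin => pt; apply: cvgMl_tmp.
Qed.

(** To agree with one's interpolation polynomial is a linear condition on
    finitely many values at a time, hence survives pointwise limits. *)
Lemma is_poly_cvg D (F : nat -> ('I_s -> nat) -> R) f :
  (forall m, is_poly D (F m)) ->
  (forall nu, (fun m => F m nu) @ \oo --> f nu) -> is_poly D f.
Proof.
move=> polF F_cvg nu; apply: cvg_unique (F_cvg nu) _ => //.
have -> : (fun m => F m nu) = fun m => \sum_(alpha : {ffun 'I_s -> 'I_D.+1})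
    coef (F m) alpha * mono (fun i => alpha i) nu by apply/funext => m; apply: polF.
by apply: cvg_sum_fin => alpha; apply: cvgMr_tmp; apply: coef_cvg.
Qed.

(** Comparing the coefficients of [f (2 nu)] and [2 ^ e f nu] kills all
    coefficients of total degree other than [e]. *)
Lemma coef_homog D e f (alpha : {ffun 'I_s -> 'I_D.+1}) : is_poly D f ->
  (forall nu, f (fun i => 2 * nu i)%N = 2 ^+ e * f nu) ->
  coef f alpha != 0 -> (\sum_i alpha i = e)%N.
Proof.
move=> polf homf nz_c.
have E1 : coef (fun nu => f (fun i => 2 * nu i)%N) alpha = 2 ^+ e * coef f alpha.
  by under eq_fun do rewrite homf; rewrite coef_scale.
have E2 : coef (fun nu => f (fun i => 2 * nu i)%N) alpha =
          2 ^+ (\sum_i alpha i)%N * coef f alpha.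
  have -> : (fun nu => f (fun i => 2 * nu i)%N) = fun nu =>
      \sum_(beta : {ffun 'I_s -> 'I_D.+1})
         (2 ^+ (\sum_i beta i)%N * coef f beta) * mono (fun i => beta i) nu.
    apply/funext => nu; rewrite polf; apply: eq_bigr => beta _.
    rewrite [_ * coef _ _]mulrC -mulrA; congr (_ * _).
    rewrite /mono expr_sum -big_split /=; apply: eq_bigr => i _.
    by rewrite natrM exprMn.
  rewrite coef_sum (bigD1 alpha) //= coef_mono eqxx mulr1 [X in _ + X]big1 ?addr0 //.
  by move=> beta ne; rewrite coef_mono eq_sym (negPf ne) mulr0.
have := E1; rewrite E2 => /(mulIf nz_c) /eqP.
by rewrite -!natrX eqr_nat eqn_exp2l // => /eqP.
Qed.

(** A homogeneous polynomial has degree at most its total degree in each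
    variable. This gives a bound on the degree that is uniform in a sequence of
    such polynomials, as is needed to pass to the limit. *)
Lemma is_poly_homog D e f : is_poly D f ->
  (forall nu, f (fun i => 2 * nu i)%N = 2 ^+ e * f nu) -> is_poly e f.
Proof.
move=> polf homf.
have -> : f = fun nu => \sum_(alpha : {ffun 'I_s -> 'I_D.+1})
                          coef f alpha * mono (fun i => alpha i) nu.
  exact/funext.
apply: is_poly_sum => alpha /(coef_homog polf homf) <-; apply: is_poly_mono => i.
by rewrite (bigD1 i) //= leq_addr.
Qed.

(** Polynomial functions of unspecified degree, presented by sums of products of
    univariate polynomials: affine substitutions act on each factor. *)
Definition sum_of_products f : Prop :=
  exists r : seq (R * ('I_s -> {poly R})),
    forall nu, f nu = \sum_(t <- r) t.1 * \prod_i (t.2 i).[(nu i)%:R].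

Definition eventually_poly f : Prop :=
  exists N : nat, sum_of_products (fun nu => f (fun i => nu i + N)%N).

Lemma sum_of_products_ext f g : f =1 g -> sum_of_products f -> sum_of_products g.
Proof. by move=> /funext ->. Qed.

Lemma sum_of_products_affine f (m : nat) c : sum_of_products f ->
  sum_of_products (fun nu => f (fun i => m * nu i + c i)%N).
Proof.
case=> r rP.
exists [seq (t.1, fun i => t.2 i \Po (m%:R *: 'X + (c i)%:R%:P)) | t <- r] => nu.
rewrite rP big_map; apply: eq_bigr => t _; congr (_ * _); apply: eq_bigr => i _.
by rewrite horner_comp !hornerE natrD natrM.
Qed.

Lemma sum_of_productsB f g : sum_of_products f -> sum_of_products g ->
  sum_of_products (fun nu => f nu - g nu).
Proof.
move=> [r rP] [r' r'P]; exists (r ++ [seq (- t.1, t.2) | t <- r']) => nu.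
rewrite rP r'P big_cat big_map -sumrN; congr (_ + _).
by apply: eq_bigr => t _; rewrite mulNr.
Qed.

Lemma eventually_poly_ext f g (N : nat) :
  (forall nu, (forall i, (N <= nu i)%N) -> f nu = g nu) ->
  eventually_poly g -> eventually_poly f.
Proof.
move=> eq_fg [M polg]; exists (M + N)%N.
apply: sum_of_products_ext (sum_of_products_affine 1 (fun=> N) polg) => nu.
rewrite eq_fg => [|i]; last by rewrite addnA leq_addl.
by congr g; apply/funext => i; rewrite mul1n -addnA [(N + M)%N]addnC.
Qed.

Lemma eventually_polyB f g : eventually_poly f -> eventually_poly g ->
  eventually_poly (fun nu => f nu - g nu).
Proof.
move=> [N polf] [M polg]; exists (N + M)%N.
apply: sum_of_products_ext (sum_of_productsB (sum_of_products_affine 1 (fun=> M) polf)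
                               (sum_of_products_affine 1 (fun=> N) polg)) => nu.
congr (f _ - g _); apply/funext => i; rewrite mul1n -addnA //.
by rewrite [(N + M)%N]addnC.
Qed.

Lemma eventually_poly_sub f c : eventually_poly f ->
  eventually_poly (fun nu => f (fun i => nu i - c i)%N).
Proof.
move=> [N polf]; pose M := (\max_i c i)%N; exists (N + M)%N.
apply: sum_of_products_ext (sum_of_products_affine 1 (fun i => M - c i)%N polf) => nu.
congr f; apply/funext => i.
by rewrite mul1n addnA -addnBA ?leq_bigmax // addnAC.
Qed.

(** Up to the shift, the rescaled functions [f (m * nu)] are polynomials of the
    same degree for all [m], so their limit is a polynomial as well. *)
Lemma eventually_poly_limit f g : eventually_poly f -> exists N D, forall e : nat,
  (forall nu, (fun m : nat => f (fun i => m * nu i + N)%N / m%:R ^+ e) @ \oo --> g nu) ->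
  is_poly D g.
Proof.
case=> N [r rP]; pose t (j : 'I_(size r)) := tnth (in_tuple r) j.
exists N, (\max_j \max_i size ((t j).2 i))%N => e g_lim.
apply: is_poly_cvg g_lim => m.
have -> : (fun nu => f (fun i => m * nu i + N)%N / m%:R ^+ e) = fun nu =>
   \sum_j ((t j).1 / m%:R ^+ e) *
          \prod_i ((t j).2 i \Po (m%:R *: 'X)).[(nu i)%:R].
  apply/funext => nu; rewrite (rP (fun i => m * nu i)%N) mulr_suml big_tnth.
  apply: eq_bigr => j _; rewrite mulrAC; congr (_ * _); apply: eq_bigr => i _.
  by rewrite horner_comp !hornerE natrM.
apply: is_poly_sum => j _; apply: is_poly_product => i.
apply: leq_trans (size_comp_poly_leq _ _) _; rewrite ltnS.
apply: (@leq_trans (size ((t j).2 i)).-1).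
  have sz2 : (size (m%:R *: 'X : {poly R}) <= 2)%N.
    by rewrite (leq_trans (size_scale_leq _ _)) ?size_polyX.
  by rewrite -[leqRHS]muln1 leq_mul // -subn1 leq_subLR.
apply: leq_trans (leq_pred _) _.
apply: leq_trans (leq_bigmax j).
exact: (leq_bigmax (F := fun i => size ((t j).2 i)) i).
Qed.

End PolynomialFunctions.

(** * Dickson's lemma and counting outside an up-set *)

Section Dickson.
Context {k : nat}.

(** Induction on the number of coordinates that may vary. After one element [x0]
    is chosen, any element not above it has a coordinate smaller than that of
    [x0], and fixing this coordinate to one of finitely many values leaves one
    coordinate less. *)
Lemma dickson_on (D : {set 'I_k}) (S : set 'X_{1..k}) :
  (forall x y, S x -> S y -> forall i, i \notin D -> x i = y i) ->
  exists G : seq 'X_{1..k}, (forall g, g \in G -> S g) /\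
    forall x, S x -> exists2 g, g \in G & (g <= x)%MM.
Proof.
elim: {D}#|D| {-2}D (erefl #|D|) S => [|n IHn] D cardD S S_const.
  have [[x0 Sx0]|noS] := pselect (exists x, S x); last first.
    by exists [::]; split=> // x Sx; case: noS; exists x.
  exists [:: x0]; split=> [g|x Sx]; first by rewrite mem_seq1 => /eqP ->.
  exists x0; rewrite ?mem_seq1 //; apply/mnm_lepP => i.
  by rewrite (S_const _ _ Sx0 Sx) // (card0_eq cardD).
have [[x0 Sx0]|noS] := pselect (exists x, S x); last first.
  by exists [::]; split=> // x Sx; case: noS; exists x.
have slice (p : 'I_k * nat) : exists G : seq 'X_{1..k},
    (forall g, g \in G -> S g) /\
    forall x, S x -> p.1 \in D -> x p.1 = p.2 -> exists2 g, g \in G & (g <= x)%MM.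
  case: p => i v /=; have [iD|niD] := boolP (i \in D); last first.
    by exists [::]; split.
  have cardDi : #|D :\ i| = n by move: cardD; rewrite (cardsD1 i) iD => -[].
  have [|G [SG GP]] := IHn (D :\ i) cardDi (S `&` [set x | x i = v]).
    move=> x y [Sx xi] [Sy yi] j; rewrite in_setD1 negb_and negbK.
    by case/orP => [/eqP ->|]; [rewrite xi yi|apply: S_const].
  by exists G; split=> [g /SG[]//|x Sx _ xi]; apply: GP.
have [F FP] := boolp.choice slice.
pose ps := [seq (i, v) | i <- enum 'I_k, v <- iota 0 (x0 i)].
exists (x0 :: flatten [seq F p | p <- ps]); split=> [g|x Sx].
  rewrite in_cons => /orP[/eqP -> //|/flatten_mapP[p _]].
  by case: (FP p) => SF _ /SF.
have [le_x|/forallPn[i]] := boolP (x0 <= x)%MM; first by exists x0; rewrite ?mem_head.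
rewrite -ltnNge => lt_xi.
have iD : i \in D.
  by apply: contraLR lt_xi => /(S_const _ _ Sx Sx0) ->; rewrite ltnn.
have [_ /(_ x Sx iD erefl)[g Fg le_g]] := FP (i, x i).
exists g => //; rewrite in_cons; apply/orP; right; apply/flatten_mapP.
exists (i, x i) => //; apply/allpairsPdep; exists i, (x i).
by rewrite mem_enum mem_iota.
Qed.

Lemma dickson (S : set 'X_{1..k}) :
  exists G : seq 'X_{1..k}, (forall g, g \in G -> S g) /\
    forall x, S x -> exists2 g, g \in G & (g <= x)%MM.
Proof. by apply: (@dickson_on finset.setT) => x y _ _ i; rewrite finset.in_setT. Qed.

End Dickson.

(** The coordinates of [y] are coloured by [colour], and [y] is graded by the
    vector of its partial degrees in each colour. *)
Section GradedCounting.
Context {R : realType} {k s : nat} (colour : 'I_k -> 'I_s).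
Implicit Types (y g : 'X_{1..k}) (nu : 'I_s -> nat) (G : seq 'X_{1..k}).

Definition colour_degree y (i : 'I_s) : nat := (\sum_(e | colour e == i) y e)%N.

Definition multidegree nu : set 'X_{1..k} := [set y | colour_degree y =1 nu].

Definition above G : set 'X_{1..k} := [set y | exists2 g, g \in G & (g <= y)%MM].

Lemma colour_degreeD y y' i :
  colour_degree (y + y')%MM i = (colour_degree y i + colour_degree y' i)%N.
Proof. by rewrite /colour_degree -big_split; apply: eq_bigr => e _; rewrite mnmDE. Qed.

Lemma mdeg_colour y : mdeg y = (\sum_i colour_degree y i)%N.
Proof. by rewrite mdegE (partition_big colour predT). Qed.

Lemma mdeg_multidegree nu y : multidegree nu y -> mdeg y = (\sum_i nu i)%N.
Proof. by move=> y_nu; rewrite mdeg_colour; apply: eq_bigr => i _; rewrite y_nu. Qed.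

Definition count_avoid G nu : nat :=
  count_upto (multidegree nu `\` above G) (\sum_i nu i)%N.

(** One step of inclusion-exclusion: the vectors that avoid [G] but lie above [g]
    are the translates by [g] of the vectors avoiding the truncated differences
    [g' - g]. *)
Lemma count_avoid_cons g G nu : (forall i, (colour_degree g i <= nu i)%N) ->
  count_avoid G nu = (count_avoid (g :: G) nu +
    count_avoid [seq (g' - g)%MM | g' <- G] (fun i => nu i - colour_degree g i)%N)%N.
Proof.
move=> le_nu; rewrite /count_avoid (count_uptoID _ [set y | (g <= y)%MM]) addnC.
have subDE g' y : (g' - g <= y)%MM = (g' <= y + g)%MM.
  by apply/mnm_lepP/mnm_lepP => le_y i; have := le_y i;
    rewrite !mnmE leq_subLR addnC.
congr addn.
  congr count_upto; apply/seteqP; split=> y /=.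
    move=> [[y_nu nG] ng]; split=> // -[g']; rewrite in_cons => /orP[/eqP ->//|Gg' le_g'].
    by apply: nG; exists g'.
  move=> [y_nu nG]; split; [split=> // -[g' Gg' le_g']|move=> le_g]; apply: nG.
    by exists g'; rewrite // in_cons Gg' orbT.
  by exists g; rewrite ?mem_head.
apply/eqP; rewrite eqn_leq; apply/andP; split.
  apply: (@count_upto_inj _ _ _ _ _ _ (fun y => y - g)%MM)
    => [y [[y_nu nG] le_g] _|]; last first.
    by move=> x y [_ le_x] [_ le_y] _ _ eq_xy; rewrite -(submK le_x) eq_xy submK.
  have yg_cell : multidegree (fun i => nu i - colour_degree g i)%N (y - g)%MM.
    by move=> i; rewrite -(y_nu i) -{2}(submK le_g) colour_degreeD addnK.
  rewrite (mdeg_multidegree yg_cell); split=> //; split=> // -[_ /mapP[g' Gg' ->]].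
  by rewrite subDE submK // => le_g'; apply: nG; exists g'.
apply: (@count_upto_inj _ _ _ _ _ _ (fun y => y + g)%MM)
  => [y [y_nu nG] _|x y _ _ _ _ /addIm//].
have yg_cell : multidegree nu (y + g)%MM.
  by move=> i; rewrite colour_degreeD y_nu subnK.
rewrite (mdeg_multidegree yg_cell); split=> //; split; last exact: lem_addl.
split=> // -[g' Gg' le_g']; apply: nG; exists (g' - g)%MM; first exact: map_f.
by rewrite subDE.
Qed.

Lemma eventually_poly_count_avoid G :
  eventually_poly (fun nu => (count_avoid [::] nu)%:R : R) ->
  eventually_poly (fun nu => (count_avoid G nu)%:R : R).
Proof.
move=> pol0; elim: {G}(size G) {-2}G (erefl (size G)) => [|n IHn] [|g G] //= [szG].
apply: (@eventually_poly_ext _ _ _ (fun nu => (count_avoid G nu)%:R -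
  (count_avoid [seq (g' - g)%MM | g' <- G] (fun i => nu i - colour_degree g i)%N)%:R)
  (\max_i colour_degree g i)%N).
  move=> nu le_nu; rewrite (@count_avoid_cons g G nu) ?natrD ?addrK // => i.
  by apply: leq_trans (le_nu i); apply: leq_bigmax.
apply: eventually_polyB; first exact: IHn.
by apply: (eventually_poly_sub (colour_degree g) (IHn _ _)); rewrite size_map.
Qed.

End GradedCounting.

(** * Khovanskii's theorem on the growth of sumsets *)

Section BaseCount.

(** Stars and bars; the bound [B] on the values plays the role of infinity. *)
Lemma card_ffun_sum (Z : finType) (m B n : nat) : #|Z| = m.+1 -> (n < B)%N ->
  #|[set g : {ffun Z -> 'I_B} | (\sum_z g z == n)%N]%SET| = 'C(m + n, m).
Proof.
case: B => // B cardZ lt_nB; rewrite -card_ord_partitions.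
pose h (j : 'I_m.+1) : Z := enum_val (cast_ord (esym cardZ) j).
pose h' (z : Z) : 'I_m.+1 := cast_ord cardZ (enum_rank z).
have hK : cancel h h' by move=> j; rewrite /h /h' enum_valK cast_ordKV.
have h'K : cancel h' h by move=> z; rewrite /h /h' cast_ordK enum_rankK.
pose F (t : m.+1.-tuple 'I_n.+1) : {ffun Z -> 'I_B.+1} :=
  [ffun z => inord (tnth t (h' z))].
have FE t z : F t z = tnth t (h' z) :> nat.
  by rewrite ffunE inordK // (leq_trans (ltn_ord _)).
have F_inj : injective F.
  move=> t t' eq_F; apply: eq_from_tnth => j; apply: val_inj.
  by have := congr1 (fun g : {ffun Z -> 'I_B.+1} => g (h j) : nat) eq_F;
    rewrite !FE hK.
have sumF (t : m.+1.-tuple 'I_n.+1) : (\sum_z F t z = \sum_(x <- t) x)%N.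
  rewrite [RHS]big_tuple (reindex h) /=; last by exists h' => ? _.
  by apply: eq_bigr => j _; rewrite FE hK.
rewrite -(card_imset _ F_inj); apply: eq_card => g; rewrite finset.inE.
apply/idP/imsetP => [/eqP sum_g|[t + ->]]; last by rewrite finset.inE sumF.
have le_g z : (g z < n.+1)%N by rewrite ltnS -sum_g (bigD1 z) //= leq_addr.
pose t : m.+1.-tuple 'I_n.+1 := [tuple inord (g (h j)) | j < m.+1].
have tE : g = F t.
  by apply/ffunP => z; apply: val_inj; rewrite /= FE tnth_mktuple h'K inordK.
by exists t; rewrite // finset.inE -sumF -tE sum_g.
Qed.

Variables (s : nat) (Z : finType).

Let E : finType := ('I_s * Z)%type.

Definition pair_colour (e : 'I_#|E|) : 'I_s := (enum_val e).1.

Lemma count_multidegree (m : nat) (nu : 'I_s -> nat) : #|Z| = m.+1 ->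
  count_avoid pair_colour [::] nu = (\prod_i 'C(m + nu i, m))%N.
Proof.
move=> cardZ; set N := (\sum_i nu i)%N.
have lt_nu i : (nu i < N.+1)%N by rewrite ltnS /N (bigD1 i) //= leq_addr.
under eq_bigr do rewrite -(card_ffun_sum cardZ (lt_nu _)).
pose rows (i : 'I_s) := [set g : {ffun Z -> 'I_N.+1} | (\sum_z g z == nu i)%N]%SET.
have -> : (\prod_i #|rows i| = #|family rows|)%N.
  by rewrite card_family foldrE big_map big_enum.
pose Phi (f : {ffun 'I_s -> {ffun Z -> 'I_N.+1}}) : 'X_{1..#|E|} :=
  [multinom (f (enum_val e).1 (enum_val e).2 : nat) | e < #|E|].
have rowPhi f i : colour_degree pair_colour (Phi f) i = (\sum_z f i z)%N.
  rewrite /colour_degree; under eq_bigr do rewrite mnmE.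
  transitivity (\sum_(p : E | p.1 == i) f p.1 p.2)%N.
    rewrite [RHS](reindex (fun e : 'I_#|E| => enum_val e)) //.
    by exists enum_rank => e _; rewrite ?enum_valK ?enum_rankK.
  transitivity (\sum_(j | j == i) \sum_z f j z)%N; last by rewrite big_pred1_eq.
  by rewrite pair_big_dep; apply: eq_bigl => p; rewrite andbT.
have cell_lt f : f \in family rows -> (mdeg (Phi f) < N.+1)%N.
  move=> /familyP fam_f; rewrite (@mdeg_multidegree _ _ pair_colour nu) // => i.
  by rewrite rowPhi; have := fam_f i; rewrite finset.inE => /eqP.
pose g f : 'X_{1..#|E| < N.+1} := insubd (@bm0 _ N) (Phi f).
have gE f : f \in family rows -> bmnm (g f) = Phi f.
  by move=> /cell_lt lt_f; rewrite /g /insubd insubT.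
have g_inj : {in family rows &, injective g}.
  move=> f f' Ff Ff' /(congr1 (@bmnm _ N.+1)); rewrite !gE // => /mnmP eq_f.
  apply/ffunP => i; apply/ffunP => z; apply: val_inj.
  by have := eq_f (enum_rank (i, z)); rewrite !mnmE enum_rankK.
rewrite -(card_in_imset g_inj); apply: eq_card => y; rewrite finset.inE.
apply/asboolP/imsetP => [[y_nu _]|[f Ff ->]]; last first.
  split=> [i|[g0]]; last by rewrite in_nil.
  by rewrite gE // rowPhi; have /familyP/(_ i) := Ff; rewrite finset.inE => /eqP.
pose f : {ffun 'I_s -> {ffun Z -> 'I_N.+1}} :=
  [ffun i => [ffun z => inord (y (enum_rank (i, z)))]].
have fE : Phi f = y.
  apply/mnmP => e; rewrite mnmE !ffunE inordK -?surjective_pairing ?enum_valK //.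
  by rewrite (leq_ltn_trans (mdeg_ge _ _)) // bmdeg.
have Ff : f \in family rows.
  by apply/familyP => i; rewrite finset.inE -rowPhi fE y_nu.
by exists f => //; apply: val_inj; rewrite /= gE.
Qed.

Lemma binomial_poly (R : numFieldType) (m : nat) :
  exists p : {poly R}, forall n : nat, p.[n%:R] = 'C(m + n, m)%:R.
Proof.
elim: m => [|m [p pP]]; first by exists 1 => n; rewrite hornerE bin0.
exists (m.+1%:R^-1 *: (('X + m.+1%:R%:P) * p)) => n.
rewrite hornerZ hornerM hornerD hornerX hornerC pP -natrD -natrM.
by rewrite addnS [(n + m)%N]addnC (mul_bin_diag (m + n).+1) natrM mulKf // pnatr_eq0.
Qed.

End BaseCount.

Section Khovanskii.
Context {R : realType} {d s : nat}.
Variables (A : 'I_s -> nat -> set 'X_{1..d}) (C p : nat).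
Hypothesis admA : admissible A C.

Let Z : finType := 'X_{1..d < (C * p).+1}.
Let E : finType := ('I_s * Z)%type.
Let k := #|E|.
Let L := (C * p)%N.

(** All colours share the index set [Z], the monomials of degree at most [L]. An
    index that is not an exponent in the ideal at hand is sent to some fixed
    exponent of that ideal, repetitions being harmless. *)
Lemma generators_ex : exists v : E -> 'X_{1..d},
  [/\ forall e, A e.1 p (v e), forall e, (mdeg (v e) <= L)%N &
      forall i x, A i p x -> (mdeg x <= L)%N -> exists z, v (i, z) = x].
Proof.
have [a aP] := boolp.choice (fun i => adm_small admA i p).
exists (fun e => if `[< A e.1 p (bmnm e.2) >] then bmnm e.2 else a e.1).
split=> [e|e|i x Ax le_x].
- by case: asboolP => // _; case: (aP e.1).
- by case: asboolP => // _; [rewrite -ltnS bmdeg|case: (aP e.1)].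
by exists (BMultinom (le_x : (mdeg x < L.+1)%N)); rewrite /=; case: asboolP.
Qed.

Section Generators.
Variable v : E -> 'X_{1..d}.
Hypothesis vA : forall e, A e.1 p (v e).
Hypothesis v_le : forall e, (mdeg (v e) <= L)%N.
Hypothesis v_onto : forall i x, A i p x -> (mdeg x <= L)%N -> exists z, v (i, z) = x.

Let colour := @pair_colour s Z.
Implicit Types (y : 'X_{1..k}) (nu : 'I_s -> nat).

Definition vsum y : 'X_{1..d} := (\sum_(e < k) v (enum_val e) *+ y e)%MM.

Definition trunc nu : set 'X_{1..d} :=
  [set x | sum_upset (fun i => power_family A p i (nu i)) x /\
           (mdeg x <= L * \sum_i nu i)%N].

Lemma vsumD y y' : vsum (y + y')%MM = (vsum y + vsum y')%MM.
Proof.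
rewrite /vsum -big_split /=; apply: eq_bigr => e _; apply/mnmP => i.
by rewrite !mnmDE !mulmnE mulnDr.
Qed.

Lemma vsum_trunc nu y : multidegree colour nu y -> trunc nu (vsum y).
Proof.
move=> y_nu; split.
  exists (fun i => \sum_(e < k | colour e == i) v (enum_val e) *+ y e)%MM; split=> [i|].
    rewrite /power_family -(y_nu i) /colour_degree.
    apply: (big_ind2 (fun n x => nfold (A i p) n x)) => // [n x n' x' nx nx'|e /eqP <-].
      exact: nfoldD.
    exact: (nfold_muln _ (vA _)).
  rewrite /vsum (partition_big colour predT) //=; exact: lepm_refl.
rewrite -(mdeg_multidegree y_nu) [mdeg y]mdegE mdeg_sum big_distrr leq_sum // => e _.
by rewrite mdegMn leq_mul ?v_le.
Qed.

Lemma sum_upset_gen nu x : sum_upset (fun i => power_family A p i (nu i)) x ->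
  exists g, [/\ sum_upset (fun i => power_family A p i (nu i)) g, (g <= x)%MM &
                (mdeg g <= L * \sum_i nu i)%N].
Proof.
move=> [y [By le_x]].
have [g gP] := boolp.choice (fun i => adm_gen (power_family_adm admA p) (By i)).
exists (\sum_i g i)%MM; split.
- by apply: mem_sum_upset => i; case: (gP i).
- apply: lepm_trans le_x; apply/mnm_lepP => j; rewrite !mnm_sumE leq_sum // => i _.
  by case: (gP i) => _ /mnm_lepP.
- by apply: mdeg_sum_le => i; case: (gP i).
Qed.

(** Truncating at degree [L * |nu|] is compatible with Minkowski sums: what an
    exponent has in excess of a sum of generators is distributed among the
    summands, none of which needs to exceed the degree [L]. *)
Lemma trunc_vsum nu x : trunc nu x -> exists2 y, multidegree colour nu y & vsum y = x.
Proof.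
elim: {nu}(\sum_i nu i)%N {-2}nu (erefl (\sum_i nu i)%N) x => [|n IHn] nu sum_nu x [Ax].
  rewrite sum_nu muln0 leqn0 mdeg_eq0 => /eqP ->.
  exists 0%MM; last by rewrite /vsum big1 // => e _; rewrite mnm0E.
  move=> i; rewrite /colour_degree big1 => [|e _]; last by rewrite mnm0E.
  by move/eqP: sum_nu; rewrite sum_nat_eq0 => /forallP/(_ i)/eqP.
rewrite sum_nu => le_x.
have [i nu_i] : exists i, (0 < nu i)%N.
  apply: contrapT => /forallNP nu0; move: sum_nu; rewrite big1 // => i _.
  by apply/eqP; rewrite -leqn0 leqNgt; apply/negP.
pose nu' j := (nu j - (j == i))%N.
have nuE j : nu j = (nu' j + (j == i))%N.
  by rewrite /nu'; case: eqP => [->|_]; rewrite ?subn0 ?addn0 // subnK.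
have sum_nu' : (\sum_j nu' j)%N = n.
  apply: succn_inj; rewrite -sum_nu [RHS](eq_bigr _ (fun j _ => nuE j)) big_split /=.
  rewrite [X in (_ + X)%N](bigD1 i) //= eqxx [X in (_ + (_ + X))%N]big1 ?addn1 //.
  by move=> j /negPf ->.
(* The remaining summands must be replaced by generators too, lest their sum
     exceed the degree allowed for [nu']. *)
have [g [G [Ag le_g AG le_G le_gG]]] : exists g G,
    [/\ A i p g, (mdeg g <= L)%N, sum_upset (fun j => power_family A p j (nu' j)) G,
        (mdeg G <= L * n)%N & (g + G <= x)%MM].
  have [y [By le_yx]] := Ax.
  have := By i; rewrite nuE eqxx addn1 /power_family /= => -[u [w [Au Aw yE]]].
  have [g [Ag le_gu le_gL]] := adm_gen admA Au.
  pose y' j := if j == i then w else y j.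
  have By' j : power_family A p j (nu' j) (y' j).
    rewrite /y'; case: eqP => [->|/eqP ne] //.
    by have := By j; rewrite nuE (negPf ne) addn0.
  have [G [AG le_Gy le_GL]] := sum_upset_gen (mem_sum_upset By').
  exists g, G; split=> //; first by rewrite -sum_nu'.
  apply: lepm_trans le_yx; rewrite (bigD1 i) //= yE -addmA; apply: lem_addm => //.
  apply: lepm_trans le_Gy _; rewrite (bigD1 i) //= {1}/y' eqxx.
  rewrite (eq_bigr y) ?lepm_refl // => j ne_ji.
  by rewrite /y' (negPf ne_ji).
(* The excess r first fills the summand of colour i up to degree L. *)
set r := (x - (g + G))%MM.
have [h [le_h deg_h]] := @sub_mdeg _ r (minn (mdeg r) (L - mdeg g)) (geq_minl _ _).
have rE : x = (g + G + r)%MM by rewrite addmC submK.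
pose x' := (G + (r - h))%MM.
have xE : x = (x' + (g + h))%MM.
  rewrite rE -[X in (g + G + X)%MM](submK le_h) /x'.
  by apply/mnmP => j; rewrite !mnmDE; lia.
have deg_rh : mdeg (r - h)%MM = (mdeg r - mdeg h)%N.
  by rewrite -[in RHS](submK le_h) mdegD addnK.
have deg_x : mdeg x = (mdeg g + mdeg G + mdeg r)%N by rewrite {1}rE !mdegD.
have [z vz] : exists z, v (i, z) = (g + h)%MM.
  apply: v_onto; first exact: (adm_up admA).
  by rewrite mdegD deg_h; lia.
have [|y y_nu' vsum_y] := IHn nu' sum_nu' x'.
  split; first exact: upclosed_sum_upset.
  rewrite sum_nu' /x' mdegD deg_rh deg_h; move: le_x; rewrite deg_x mulnS; lia.
exists (y + U_(enum_rank (i, z)))%MM.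
  move=> j; rewrite colour_degreeD y_nu' nuE; congr addn; rewrite /colour_degree.
  rewrite (big_mkcond (fun e => colour e == j)) (bigD1 (enum_rank (i, z))) //=.
  rewrite big1 => [|e ne_e].
    by rewrite addn0 mnm1E eqxx /colour /pair_colour enum_rankK eq_sym; case: eqP.
  by case: ifP => // _; rewrite mnm1E eq_sym (negPf ne_e).
rewrite vsumD vsum_y xE -vz; congr mnm_add.
rewrite /vsum (bigD1 (enum_rank (i, z))) //= mnm1E eqxx mulm1n enum_rankK.
by rewrite big1 ?addm0 // => e ne_e; rewrite mnm1E eq_sym (negPf ne_e).
Qed.

(** The monomial order is total and compatible with addition, so each element of
    the sumset has exactly one representation that is minimal for it. *)
Definition redundant : set 'X_{1..k} :=
  [set y | exists y', [/\ (y' < y)%O,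
     colour_degree colour y' =1 colour_degree colour y & vsum y' = vsum y]].

Lemma redundant_up : upclosed redundant.
Proof.
move=> y z [y' [lt_y row_y vsum_y]]; exists (y' + z)%MM; split.
- by rewrite ltmc_add2l.
- by move=> i; rewrite !colour_degreeD row_y.
- by rewrite !vsumD vsum_y.
Qed.

Lemma irredundant_ex y : exists y',
  [/\ colour_degree colour y' =1 colour_degree colour y, vsum y' = vsum y
     & ~ redundant y'].
Proof.
elim/(well_founded_ind (@ltom_wf k)): y => y IHy.
have [[y' [lt_y row_y vsum_y]]|nred] := pselect (redundant y); last by exists y.
have [y'' [row_y'' vsum_y'' nred]] := IHy y' lt_y.
by exists y''; split=> // [i|]; rewrite ?row_y'' // vsum_y''.
Qed.

(** Sums are counted by their minimal representations. *)
Lemma trunc_count_irredundant nu :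
  trunc_count (power_family A p) L nu =
    count_upto (multidegree colour nu `\` redundant) (\sum_i nu i)%N.
Proof.
rewrite /trunc_count; apply/eqP; rewrite eqn_leq; apply/andP; split.
  pose S x := [set y | [/\ multidegree colour nu y, vsum y = x & ~ redundant y]].
  pose f x := xget 0%MM (S x).
  have fP x : trunc nu x -> S x (f x).
    move=> /trunc_vsum[y y_nu vsum_y].
    have [y' [row_y' vsum_y' nred]] := irredundant_ex y.
    apply: (@xgetPex _ 0%MM (S x)).
    by exists y'; split=> // [i|]; rewrite ?row_y' ?y_nu // vsum_y'.
  apply: (@count_upto_inj _ _ _ _ _ _ f) => [x Ax le_x|x y Ax Ay le_x le_y eq_f].
    have [f_nu _ nred] := fP x (conj Ax le_x).
    by rewrite (mdeg_multidegree f_nu).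
  have [_ <- _] := fP x (conj Ax le_x); have [_ <- _] := fP y (conj Ay le_y).
  by rewrite eq_f.
apply: (@count_upto_inj _ _ _ _ _ _ vsum)
  => [y [y_nu _] _|y y' [y_nu nred] [y'_nu nred'] _ _ eq_v].
  exact: vsum_trunc.
apply/eqP; case: ltgtP => // lt_y.
  by case: nred'; exists y; split=> // i; rewrite y_nu y'_nu.
by case: nred; exists y'; split=> // i; rewrite y_nu y'_nu.
Qed.

End Generators.

(** Dickson's lemma presents the redundant representations by finitely many
    generators, and inclusion-exclusion reduces the count to that of all vectors
    with given partial degrees, a product of binomial coefficients. *)
Lemma eventually_poly_trunc_count :
  eventually_poly (fun nu : 'I_s -> nat =>
    (trunc_count (power_family A p) (C * p) nu)%:R : R).
Proof.
have [v [vA v_le v_onto]] := generators_ex.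
have [G [GW WG]] := dickson (redundant v).
have -> : (fun nu : 'I_s -> nat => (trunc_count (power_family A p) (C * p) nu)%:R : R) =
          fun nu => (count_avoid (@pair_colour s Z) G nu)%:R.
  apply/funext => nu; rewrite (trunc_count_irredundant vA v_le v_onto) /count_avoid.
  congr (_%:R); congr (count_upto (_ `\` _) _); apply/seteqP; split=> y.
    by move=> /WG[g Gg le_g]; exists g.
  by move=> [g /GW Wg le_g]; apply: upclosed_le (@redundant_up v) Wg le_g.
apply: eventually_poly_count_avoid.
have [m cardZ] : exists m, #|Z| = m.+1.
  exists #|Z|.-1; rewrite prednK //; apply/card_gt0P; exists (@bm0 d L) => //.
have [q qP] := binomial_poly R m.
exists 0%N; exists [:: (1, fun=> q)] => nu.
rewrite big_seq1 mul1r (count_multidegree _ cardZ) natr_prod; apply: eq_bigr => i _.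
by rewrite qP addn0.
Qed.

End Khovanskii.

Section VolumePolynomial.
Context {R : realType} {d s : nat}.
Hypothesis d_gt0 : (0 < d)%N.
Variables (A : 'I_s -> nat -> set 'X_{1..d}) (C : nat).
Hypothesis admA : admissible A C.

(** Khovanskii's theorem gives a polynomial of some degree depending on [p]; the
    scaling behaviour of volumes brings it down to [d]. *)
Lemma vol_power_is_poly p : is_poly d (@vol R d s (power_family A p) (C * p)).
Proof.
have [N [D polD]] := @eventually_poly_limit R s _ (vol (power_family A p) (C * p))
  (@eventually_poly_trunc_count R d s A C p admA).
apply: (@is_poly_homog _ _ D).
  by apply: (polD d) => nu; apply: (@vol_power_shift R d s d_gt0 A C admA p nu (fun=> N)).
by move=> nu; apply: (volM d_gt0 (power_family_adm admA p)).
Qed.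

Lemma vol_is_poly : is_poly d (@vol R d s A C).
Proof.
apply: is_poly_cvg (vol_power_cvg d_gt0 admA) => p.
exact/is_polyZ/vol_power_is_poly.
Qed.

End VolumePolynomial.

(** * Monomial ideals as up-sets of exponents *)

Section ExponentSets.
Context {k : fieldType} {d : nat}.
Implicit Types (E F : set 'X_{1..d}) (I J : set {mpoly k[d]}).

Definition supported_on E : set {mpoly k[d]} := [set f | forall m, m \in msupp f -> E m].

Definition exponents I : set 'X_{1..d} := [set m | I 'X_[m]].

Lemma supported_setT : supported_on setT = setT.
Proof. by apply/seteqP; split. Qed.

Lemma supported_sub E F : E `<=` F -> supported_on E `<=` supported_on F.
Proof. by move=> EF f fE m /fE /EF. Qed.

Lemma exponents_supported E : exponents (supported_on E) = E.
Proof.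
apply/seteqP; split=> m /=; first by apply; rewrite msuppX mem_seq1.
by move=> Em m'; rewrite msuppX mem_seq1 => /eqP ->.
Qed.

Lemma supportedX E m : E m -> supported_on E 'X_[m].
Proof. by rewrite -{1}(exponents_supported E). Qed.

Lemma supported0 E : supported_on E 0.
Proof. by move=> m; rewrite msupp0. Qed.

Lemma supportedD E f g : supported_on E f -> supported_on E g -> supported_on E (f + g).
Proof. by move=> fE gE m /msuppD_le; rewrite mem_cat => /orP[/fE|/gE]. Qed.

Lemma supportedZ E c f : supported_on E f -> supported_on E (c *: f).
Proof. by move=> fE m /msuppZ_le /fE. Qed.

Lemma supported_sum E (T : eqType) (r : seq T) (G : T -> {mpoly k[d]}) :
  (forall t, t \in r -> supported_on E (G t)) -> supported_on E (\sum_(t <- r) G t).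
Proof.
move=> GE; rewrite big_seq; apply: (big_ind (supported_on E)) => //.
  exact: supported0.
exact: supportedD.
Qed.

Lemma supportedM E F f g : supported_on E f -> supported_on F g ->
  supported_on (sumset E F) (f * g).
Proof.
move=> fE gF m /msuppM_le /allpairsP[[a b] /= [/fE Ea /gF Fb ->]].
by exists a, b.
Qed.

(** The second factor may be a mere set of generators, so that this covers both
    products of ideals and ideals generated by monomials. *)
Lemma idealM_gen (P Q : set 'X_{1..d}) (S : set {mpoly k[d]}) :
  (forall m, Q m -> S 'X_[m]) -> S `<=` supported_on Q ->
  idealM (supported_on P) S = supported_on (sumset P Q).
Proof.
move=> QS SQ; apply/seteqP; split=> f.
  move=> [s [sP ->]]; apply: supported_sum => u /sP[Pu Su].
  by apply: supportedM => //; apply: SQ.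
move=> fE.
have [a aP] : exists a : 'X_{1..d} -> 'X_{1..d} * 'X_{1..d}, forall m,
    m \in msupp f -> [/\ P (a m).1, Q (a m).2 & m = ((a m).1 + (a m).2)%MM].
  have ex m : exists p : 'X_{1..d} * 'X_{1..d},
      m \in msupp f -> [/\ P p.1, Q p.2 & m = (p.1 + p.2)%MM].
    have [/fE[x [y [Px Qy ->]]]|_] := boolP (m \in msupp f); first by exists (x, y).
    by exists (0%MM, 0%MM).
  by have [a aP] := boolp.choice ex; exists a.
exists [seq (f@_m *: 'X_[(a m).1], 'X_[(a m).2]) | m <- msupp f]; split.
  move=> _ /mapP[m mf ->] /=; have [Pm Qm _] := aP m mf.
  by split; [exact: (supportedZ (supportedX Pm))|exact: (QS _ Qm)].
rewrite big_map {1}[f]mpolyE big_seq [RHS]big_seq; apply: eq_bigr => m mf.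
have [_ _ mE] := aP m mf.
by rewrite -scalerAl -mpolyXD -mE.
Qed.

Lemma idealM_supported E F :
  idealM (supported_on E) (supported_on F) = supported_on (sumset E F).
Proof. by apply: idealM_gen => // m; apply: supportedX. Qed.

Lemma idealX_supported E n : idealX (supported_on E) n = supported_on (nfold E n).
Proof.
elim: n => [|n IHn]; first by rewrite /idealX /= supported_setT.
by rewrite /idealX /= -/(idealX _ _) IHn idealM_supported.
Qed.

Lemma big_idealM_supported (r : nat) (B : 'I_r -> set 'X_{1..d}) :
  \big[idealM/setT]_(i < r) supported_on (B i) = supported_on (sum_upset B).
Proof.
have -> : sum_upset B = \big[sumset/setT]_(i < r) B i.
  elim: r B => [|r IHr] B.
    rewrite big_ord0; apply/seteqP; split=> // x _.
    by exists (fun=> 0%MM); split=> [[]//|]; rewrite big_ord0; apply: lem0m.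
  rewrite big_ord_recl -IHr; apply/seteqP; split=> x.
    move=> [y [By]]; rewrite big_ord_recl => le_x.
    exists (y ord0), (x - y ord0)%MM; split=> //.
      exists (fun j => y (lift ord0 j)); split=> //.
      apply/mnm_lepP => i; have /mnm_lepP/(_ i) := le_x.
      rewrite mnmDE mnmBE => le_xi.
      by rewrite -(leq_add2l (y ord0 i)) subnKC // (leq_trans (leq_addr _ _) le_xi).
    by rewrite addmC submK // (lepm_trans _ le_x) // lem_addr.
  move=> [u [v [Bu [y [By le_v]] ->]]].
  exists (fun i => if unlift ord0 i is Some j then y j else u); split.
    by move=> i; case: unliftP => [j ->|->].
  rewrite big_ord_recl unlift_none; apply: lem_addm; first exact: lepm_refl.
  by under eq_bigr do rewrite liftK.
elim: r B => [|r IHr] B; first by rewrite !big_ord0 supported_setT.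
by rewrite !big_ord_recl IHr idealM_supported.
Qed.

Lemma monomial_idealE I : monomial_ideal I ->
  upclosed (exponents I) /\ I = supported_on (exponents I).
Proof.
move=> [M ->].
have -> : ideal_gen [set 'X_[m] | m in M] = supported_on (sumset setT M).
  rewrite /ideal_gen -supported_setT; apply: idealM_gen => [m Mm|_ [m Mm <-]].
    by exists m.
  exact: supportedX.
rewrite exponents_supported; split=> // x y [a [b [_ Mb ->]]].
by exists (a + y)%MM, b; split=> //; rewrite -!addmA [(b + y)%MM]addmC.
Qed.

(** Exchange argument: if [n] vectors are expressed by fewer vectors modulo [V2],
    the matrix of coefficients has a nonzero row kernel, which is a linear relation
    modulo [V2]. *)
Lemma quot_dim_le (V : lmodType k) (V1 V2 : set V) n n' :
  (forall f g, V2 f -> V2 g -> V2 (f + g)) -> (forall c f, V2 f -> V2 (c *: f)) ->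
  V2 0 -> is_quot_dim V1 V2 n -> is_quot_dim V1 V2 n' -> (n <= n')%N.
Proof.
move=> V2D V2Z V20 [b [bV b_free _]] [b' [_ _ b'_gen]].
have [c cP] := boolp.choice (fun i => b'_gen (b i) (bV i)).
pose M : 'M[k]_(n, n') := \matrix_(i, j) c i j.
rewrite leqNgt; apply/negP => lt_n.
have : kermx M != 0.
  rewrite -mxrank_eq0 mxrank_ker subn_eq0 -ltnNge.
  exact: leq_ltn_trans (rank_leq_col M) lt_n.
have V2_sum (m : nat) (G : 'I_m -> V) :
    (forall i, V2 (G i)) -> V2 (\sum_i G i).
  by move=> GV; apply: (big_ind V2).
move=> /rowV0Pn[u /sub_kermxP uM]; case/negP; apply/eqP/rowP => i.
rewrite mxE; apply: (b_free (fun i => u 0 i)).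
have -> : \sum_i u 0 i *: b i = \sum_i u 0 i *: (b i - \sum_j c i j *: b' j).
  under [RHS]eq_bigr do rewrite scalerBr.
  rewrite sumrB [X in _ - X](_ : _ = 0) ?subr0 //.
  under eq_bigr do rewrite scaler_sumr.
  rewrite exchange_big /= big1 // => j _.
  under eq_bigr do rewrite scalerA.
  have uM0 : \sum_i u 0 i * c i j = 0.
    have := congr1 (fun v : 'rV_n' => v 0 j) uM; rewrite [RHS]mxE [LHS]mxE; apply: etrans.
    by apply: eq_bigr => l _; rewrite mxE.
  by rewrite -scaler_suml uM0 scale0r.
by apply: V2_sum => l; apply: V2Z.
Qed.

(** The monomials with exponents in [E] but not in [F] form a basis. *)
Lemma quot_dim_supported E F L : F `<=` E ->
  (forall x, E x -> ~ F x -> (mdeg x <= L)%N) ->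
  (quot_dim (supported_on E) (supported_on F) = count_upto E L - count_upto F L)%N.
Proof.
move=> FE le_L; pose D := [set x : 'X_{1..d < L.+1} | `[< (E `\` F) x >]]%SET.
have -> : (count_upto E L - count_upto F L = #|D|)%N.
  by rewrite (count_uptoID E F) setIC (setIidl FE) addKn.
have dimD : is_quot_dim (supported_on E) (supported_on F) #|D|.
  exists (fun i : 'I_#|D| => 'X_[bmnm (enum_val i)]).
  have DP (i : 'I_#|D|) : (E `\` F) (enum_val i).
    by have := enum_valP i; rewrite finset.inE => /asboolP.
  have coefD (c : 'I_#|D| -> k) (i : 'I_#|D|) :
      (\sum_j c j *: 'X_[bmnm (enum_val j)])@_(bmnm (enum_val i)) = c i.
    rewrite raddf_sum (bigD1 i) //= mcoeffZ mcoeffX eqxx mulr1 big1 ?addr0 // => j ne_ji.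
    rewrite mcoeffZ mcoeffX (inj_eq val_inj) (inj_eq enum_val_inj).
    by rewrite (negPf ne_ji) mulr0.
  split=> [i|c cF i|f fE].
  - by apply: supportedX; case: (DP i).
  - rewrite -(coefD c i); apply: memN_msupp_eq0; apply/negP => /cF.
    by case: (DP i).
  exists (fun i => f@_(bmnm (enum_val i))) => m; rewrite mcoeff_msupp => nz_m.
  apply: contrapT => nFm; move: nz_m; apply/negP; rewrite negbK mcoeffB subr_eq0.
  have [mD|nDm] := pselect (E m).
    have lt_m : (mdeg m < L.+1)%N by rewrite ltnS le_L.
    have mD' : BMultinom lt_m \in D by rewrite finset.inE; apply/asboolP.
    have := coefD (fun i => f@_(bmnm (enum_val i))) (enum_rank_in mD' (BMultinom lt_m)).
    by rewrite enum_rankK_in //= => ->.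
  rewrite memN_msupp_eq0; last by apply/negP => /fE.
  rewrite raddf_sum big1 // => i _; rewrite /= mcoeffZ mcoeffX.
  by case: eqP => [eq_m|_]; rewrite ?mulr0 //; case: nDm; rewrite -eq_m; case: (DP i).
have dimq : is_quot_dim (supported_on E) (supported_on F)
    (quot_dim (supported_on E) (supported_on F)).
  apply: (@xgetPex _ 0%N (is_quot_dim (supported_on E) (supported_on F))).
  by exists #|D|.
apply/eqP; rewrite eqn_leq; apply/andP; split.
  apply: quot_dim_le dimq dimD; [exact: supportedD|exact: supportedZ|].
  exact: supported0.
apply: quot_dim_le dimD dimq; [exact: supportedD|exact: supportedZ|].
exact: supported0.
Qed.

End ExponentSets.

(** * The coefficients of the mixed multiplicity polynomial *)

Section MixedPoly.
Context {R : realType} {r d' : nat}.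
Let d := d'.+1.

Definition cons_index (n0 : nat) (n : 'I_r -> nat) (i : 'I_r.+1) : nat :=
  if unlift ord0 i is Some j then n j else n0.

Lemma cons_index0 n0 n : cons_index n0 n ord0 = n0.
Proof. by rewrite /cons_index unlift_none. Qed.

Lemma cons_indexS n0 n j : cons_index n0 n (lift ord0 j) = n j.
Proof. by rewrite /cons_index liftK. Qed.

Lemma sum_cons_index n0 n : (\sum_i cons_index n0 n i = n0 + \sum_j n j)%N.
Proof.
rewrite big_ord_recl cons_index0; congr addn; apply: eq_bigr => j _.
by rewrite cons_indexS.
Qed.

Lemma cons_index_eta (nu : 'I_r.+1 -> nat) :
  cons_index (nu ord0) (fun j => nu (lift ord0 j)) = nu.
Proof. by apply/funext => i; rewrite /cons_index; case: unliftP => [j ->|->]. Qed.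

Lemma mono_cons_index (alpha : 'I_r.+1 -> nat) n0 n :
  mono alpha (cons_index n0 n) =
    n0%:R ^+ alpha ord0 * \prod_(j < r) (n j)%:R ^+ alpha (lift ord0 j) :> R.
Proof.
rewrite /mono big_ord_recl cons_index0; congr (_ * _); apply: eq_bigr => j _.
by rewrite cons_indexS.
Qed.

(** The shift by one in the first variable reflects that all terms are
    divisible by [n0]. *)
Definition mixed_exponent (q : 'I_d * {ffun 'I_r -> 'I_d}) :
    {ffun 'I_r.+1 -> 'I_d.+1} :=
  [ffun i => inord (cons_index q.1.+1 (fun j => q.2 j) i)].

Definition mixed_exponent_inv (alpha : {ffun 'I_r.+1 -> 'I_d.+1}) :
    'I_d * {ffun 'I_r -> 'I_d} :=
  (inord (alpha ord0).-1, [ffun j => inord (alpha (lift ord0 j))]).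

Lemma mixed_exponent0 q : mixed_exponent q ord0 = q.1.+1 :> nat.
Proof. by rewrite ffunE cons_index0 inordK // ltnS ltn_ord. Qed.

Lemma mixed_exponentS q j : mixed_exponent q (lift ord0 j) = q.2 j :> nat.
Proof. by rewrite ffunE cons_indexS inordK // ltnS ltnW. Qed.

Lemma mixed_exponentK : cancel mixed_exponent mixed_exponent_inv.
Proof.
move=> q; rewrite [q in RHS]surjective_pairing; congr pair.
  by apply: val_inj; rewrite /= mixed_exponent0 /= inordK.
by apply/ffunP => j; apply: val_inj; rewrite ffunE /= mixed_exponentS inordK.
Qed.

Definition mixed_index (q : 'I_d * {ffun 'I_r -> 'I_d}) : bool :=
  (q.1 + \sum_(i < r) q.2 i).+1 == d.

Definition mixed_factor (q : 'I_d * {ffun 'I_r -> 'I_d}) : R :=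
  (q.1.+1`! * \prod_(i < r) (q.2 i)`!)%:R.

Lemma mixed_factor_neq0 q : mixed_factor q != 0.
Proof.
rewrite pnatr_eq0 muln_eq0 negb_or -!lt0n fact_gt0 /=.
by rewrite prodn_gt0 // => i; rewrite fact_gt0.
Qed.

Lemma mixed_polyE (e : nat -> ('I_r -> nat) -> R) n0 n :
  mixed_poly d e n0 n =
    \sum_(q | mixed_index q) e q.1 (fun i => q.2 i) / mixed_factor q *
       mono (fun i => mixed_exponent q i) (cons_index n0 n).
Proof.
rewrite /mixed_poly pair_big_dep; apply: eq_bigr => q _.
rewrite mono_cons_index mixed_exponent0 -mulrA; congr (_ * (_ * _)).
by apply: eq_bigr => j _; rewrite mixed_exponentS.
Qed.

Lemma mixed_poly_coef (e : nat -> ('I_r -> nat) -> R) q : mixed_index q ->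
  e q.1 (fun i => q.2 i) = mixed_factor q *
    coef (fun nu => mixed_poly d e (nu ord0) (fun j => nu (lift ord0 j)))
      (mixed_exponent q).
Proof.
move=> valid_q.
have -> : (fun nu => mixed_poly d e (nu ord0) (fun j => nu (lift ord0 j))) = fun nu =>
   \sum_q0 (if mixed_index q0 then e q0.1 (fun i => q0.2 i) / mixed_factor q0 else 0) *
             mono (fun i => mixed_exponent q0 i) nu.
  apply/funext => nu; rewrite mixed_polyE cons_index_eta big_mkcond.
  apply: eq_bigr => q0 _.
  by case: ifP => // _; rewrite mul0r.
rewrite coef_sum (bigD1 q) //= coef_mono eqxx mulr1 valid_q [X in _ + X]big1 ?addr0.
  by rewrite mulrC divfK ?mixed_factor_neq0.
move=> q0 ne_q; rewrite coef_mono (can_eq mixed_exponentK) eq_sym (negPf ne_q) mulr0 //.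
Qed.

(** Homogeneity leaves only the monomials of total degree [d], and vanishing at
    [n0 = 0] only those divisible by [n0]; these are the monomials of
    [mixed_poly]. *)
Lemma mixed_poly_ex (F : ('I_r.+1 -> nat) -> R) : is_poly d F ->
  (forall nu, F (fun i => 2 * nu i)%N = 2 ^+ d * F nu) ->
  (forall n, F (cons_index 0 n) = 0) ->
  exists e, forall n0 n, F (cons_index n0 n) = mixed_poly d e n0 n.
Proof.
move=> polF homF F0.
have coef0 (alpha : {ffun 'I_r.+1 -> 'I_d.+1}) : alpha ord0 = ord0 -> coef F alpha = 0.
  move=> alpha0.
  have E0 : (fun nu : 'I_r.+1 -> nat => 0 : R) = fun nu =>
      \sum_(beta : {ffun 'I_r.+1 -> 'I_d.+1})
        (coef F beta * (beta ord0 == ord0)%:R) * mono (fun i => beta i) nu.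
    apply/funext => nu.
    transitivity (F (cons_index 0 (fun j => nu (lift ord0 j)))) => //.
    rewrite polF.
    apply: eq_bigr => beta _; rewrite -mulrA; congr (_ * _).
    rewrite -[in RHS](cons_index_eta nu) !mono_cons_index mulrA; congr (_ * _).
    rewrite expr0n; case: (eqVneq (beta ord0) ord0) => [->|ne]; first by rewrite mul1r.
    by rewrite mul0r; case: eqP => // b0; case/eqP: ne; apply: val_inj.
  have := congr1 (fun f => coef f alpha) E0.
  rewrite coef_sum (bigD1 alpha) //= coef_mono alpha0 !eqxx !mulr1.
  rewrite [X in _ + X]big1 ?addr0.
    by move=> <-; rewrite /coef big1 // => pt _; rewrite mulr0.
  by move=> beta ne; rewrite coef_mono [alpha == _]eq_sym (negPf ne) mulr0.
exists (fun d0 dd => (d0.+1`! * \prod_(i < r) (dd i)`!)%:R *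
   coef F [ffun i => inord (cons_index d0.+1 dd i) : 'I_d.+1]) => n0 n.
rewrite mixed_polyE polF.
pose valid (alpha : {ffun 'I_r.+1 -> 'I_d.+1}) :=
  (0 < alpha ord0)%N && (\sum_i alpha i == d)%N.
rewrite (bigID valid) /= [X in _ + X]big1 ?addr0 => [|alpha]; last first.
  rewrite negb_and -leqNgt leqn0 => /orP[/eqP a0|/eqP ne_d].
    by rewrite coef0 ?mul0r //; apply: val_inj.
  have [->|/(coef_homog polF homF) //] := eqVneq (coef F alpha) 0.
  by rewrite mul0r.
rewrite (reindex_onto mixed_exponent mixed_exponent_inv) /=
  => [|alpha /andP[a0 /eqP sum_a]].
  apply: eq_big => [q|q _].
    rewrite mixed_exponentK eqxx andbT /valid mixed_exponent0 /= /mixed_index.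
    rewrite big_ord_recl mixed_exponent0 addSn.
    by congr ((_ + _).+1 == _); apply: eq_bigr => j _; rewrite mixed_exponentS.
  by congr (_ * _); rewrite mulrAC [_ / _]divff ?mul1r ?(mixed_factor_neq0 q).
have sumE : (alpha ord0 + \sum_(j < r) alpha (lift ord0 j) = d)%N.
  by apply: etrans sum_a; rewrite [RHS]big_ord_recl.
have lt_a j : (alpha (lift ord0 j) < d)%N.
  have : (alpha (lift ord0 j) <= \sum_(j < r) alpha (lift ord0 j))%N.
    by rewrite (bigD1 j) //= leq_addr.
  by lia.
apply/ffunP => i; apply: val_inj; case: (unliftP ord0 i) => [j ->|->] /=.
  by rewrite mixed_exponentS ffunE inordK.
rewrite mixed_exponent0 /= inordK ?prednK //.
by have := ltn_ord (alpha ord0); lia.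
Qed.

End MixedPoly.

(** * Mixed multiplicities as coefficients of covolumes *)

Section JoinFamilies.
Context {d r : nat}.
Implicit Types (EI : nat -> set 'X_{1..d}) (EJ : 'I_r -> nat -> set 'X_{1..d}).

Definition join_family EI EJ : 'I_r.+1 -> nat -> set 'X_{1..d} :=
  fun i n => if unlift ord0 i is Some j then EJ j n else EI n.

Lemma sum_upset_join EI EJ n0 n :
  sum_upset (fun i => join_family EI EJ i (cons_index n0 n i)) =
    sumset (EI n0) (sum_upset (fun j => EJ j (n j))).
Proof.
apply/seteqP; split=> x.
  move=> [y [By]]; rewrite big_ord_recl => le_x.
  exists (y ord0), (x - y ord0)%MM; split=> //.
  - by have := By ord0; rewrite /join_family /cons_index unlift_none.
  - exists (fun j => y (lift ord0 j)); split=> [j|].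
      by have := By (lift ord0 j); rewrite /join_family /cons_index liftK.
    apply/mnm_lepP => i; have /mnm_lepP/(_ i) := le_x.
    rewrite mnmDE mnmBE => le_xi.
    by rewrite -(leq_add2l (y ord0 i)) subnKC // (leq_trans (leq_addr _ _) le_xi).
  - by rewrite addmC submK // (lepm_trans _ le_x) // lem_addr.
move=> [u [v [Bu [y [By le_v]] ->]]].
exists (fun i => if unlift ord0 i is Some j then y j else u); split.
  by move=> i; rewrite /join_family /cons_index; case: unliftP.
rewrite big_ord_recl unlift_none; apply: lem_addm; first exact: lepm_refl.
by under eq_bigr do rewrite liftK.
Qed.

Lemma join_power_family EI EJ p :
  join_family (fun n => nfold (EI p) n) (fun j n => nfold (EJ j p) n) =
    power_family (join_family EI EJ) p.
Proof.
apply/funext => i; apply/funext => n; rewrite /power_family /join_family.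
by case: unlift.
Qed.

End JoinFamilies.

Section MixedVolumes.
Context {R : realType} {k : fieldType} {d' r : nat}.
Let d := d'.+1.
Implicit Types (EI : nat -> set 'X_{1..d}) (EJ : 'I_r -> nat -> set 'X_{1..d}).

(** Replacing [I] by the constant family of the unit ideal yields the product of
    the [J] alone, in the same number of variables and with the same
    truncation. *)
Definition covolume EI EJ C (nu : 'I_r.+1 -> nat) : R :=
  vol (join_family (fun=> setT) EJ) C nu - vol (join_family EI EJ) C nu.

Section Family.
Variables (EI : nat -> set 'X_{1..d}) (EJ : 'I_r -> nat -> set 'X_{1..d}) (C : nat).
Hypothesis adm : admissible (join_family EI EJ) C.
Hypothesis EI_big : forall n x, (C * n <= mdeg x)%N -> EI n x.

Lemma join_unit_adm : admissible (join_family (fun=> setT) EJ) C.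
Proof.
have joinS EI' j : join_family EI' EJ (lift ord0 j) = EJ j by rewrite /join_family liftK.
have join0 EI' : join_family EI' EJ ord0 = EI' by rewrite /join_family unlift_none.
split=> i; case: (unliftP ord0 i) => [j ->|->]; rewrite ?joinS ?join0 //.
- by rewrite -(joinS EI); apply: adm_up adm _.
- by rewrite -(joinS EI); apply: adm_0 adm _.
- by rewrite -(joinS EI); apply: adm_D adm _.
- by rewrite -(joinS EI); apply: adm_ne adm _.
- by exists 0%MM.
- by rewrite -(joinS EI); apply: adm_gen adm _.
- by move=> n x _; exists 0%MM; rewrite mdeg0; split=> //; apply: lem0m.
Qed.

(** An exponent of the product of the [J] whose degree exceeds the truncation
    is a generator of that product times a monomial of degree at least [C * n0],
    which lies in [EI n0]; so beyond the truncation there is nothing to count. *)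
Lemma quot_dim_join n0 n :
  quot_dim (supported_on (sum_upset (fun j => EJ j (n j))) : set {mpoly k[d]})
    (idealM (supported_on (EI n0))
       (supported_on (sum_upset (fun j => EJ j (n j))))) =
  (trunc_count (join_family (fun=> setT) EJ) C (cons_index n0 n) -
   trunc_count (join_family EI EJ) C (cons_index n0 n))%N.
Proof.
rewrite idealM_supported /trunc_count !sum_upset_join.
set Q := sum_upset (fun j => EJ j (n j)).
have upQ : upclosed Q by apply: upclosed_sum_upset.
have -> : sumset setT Q = Q.
  apply/seteqP; split=> [_ [a [b [_ Qb ->]]]|x Qx]; last first.
    by exists 0%MM, x; rewrite add0m.
  by rewrite addmC; apply: upQ.
apply: quot_dim_supported => [_ [a [b [_ Qb ->]]]|x [y [By le_yx]] nFx].
  by rewrite addmC; apply: upQ.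
rewrite leqNgt; apply/negP => lt_x; apply: nFx.
have EJ_gen j : exists g, [/\ EJ j (n j) g, (g <= y j)%MM & (mdeg g <= C * n j)%N].
  have := @adm_gen _ _ _ _ adm (lift ord0 j) (n j) (y j).
  by rewrite /join_family liftK; apply.
have [g gP] := boolp.choice EJ_gen.
have le_gx : (\sum_j g j <= x)%MM.
  apply: lepm_trans le_yx; apply/mnm_lepP => l; rewrite !mnm_sumE leq_sum // => j _.
  by case: (gP j) => _ /mnm_lepP.
exists (x - \sum_j g j)%MM, (\sum_j g j)%MM; rewrite submK //; split=> //.
  apply: EI_big; have : (mdeg (\sum_j g j)%MM <= C * \sum_j n j)%N.
    by apply: mdeg_sum_le => j; case: (gP j).
  have : mdeg x = (mdeg (x - \sum_j g j)%MM + mdeg (\sum_j g j)%MM)%N.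
    by rewrite -mdegD submK.
  by move: lt_x; rewrite sum_cons_index mulnDr; lia.
by apply: mem_sum_upset => j; case: (gP j).
Qed.

Lemma covolume_is_poly : is_poly d (covolume EI EJ C).
Proof. by apply: is_polyB; apply: vol_is_poly => //; apply: join_unit_adm. Qed.

Lemma covolume_homog nu :
  covolume EI EJ C (fun i => 2 * nu i)%N = 2 ^+ d * covolume EI EJ C nu.
Proof. by rewrite /covolume mulrBr !volM //; apply: join_unit_adm. Qed.

Lemma covolume0 n : covolume EI EJ C (cons_index 0 n) = 0.
Proof.
rewrite /covolume /vol; apply/eqP; rewrite subr_eq0; apply/eqP.
congr (lim (_ @ \oo)); apply/funext => m; congr (_%:R / _); rewrite /trunc_count.
congr count_upto; congr sum_upset; apply/funext => i.
rewrite /join_family /cons_index; case: unliftP => [//|_]; rewrite muln0.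
by have := adm_0T adm ord0; rewrite /join_family unlift_none => ->.
Qed.

Section Ideals.
Variables (I : nat -> set {mpoly k[d]}) (J : 'I_r -> nat -> set {mpoly k[d]}).
Hypothesis IE : forall n, I n = supported_on (EI n).
Hypothesis JE : forall i n, J i n = supported_on (EJ i n).

Lemma covolume_cvg n0 n :
  (fun m : nat =>
     (quot_dim (prod_family J n m)
        (idealM (I (m * n0)%N) (prod_family J n m)))%:R / m%:R ^+ d : R)
    @ \oo --> covolume EI EJ C (cons_index n0 n).
Proof.
have consM m : cons_index (m * n0) (fun j => m * n j)%N =
               (fun i => m * cons_index n0 n i)%N.
  by apply/funext => i; rewrite /cons_index; case: unliftP.
have prodE m : prod_family J n m =
               supported_on (sum_upset (fun j => EJ j (m * n j)%N)).
  by rewrite -big_idealM_supported; apply: eq_bigr => i _; rewrite JE.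
pose T EI' (m : nat) : R :=
  (trunc_count (join_family EI' EJ) C (fun i => m * cons_index n0 n i)%N)%:R
    / m%:R ^+ d.
rewrite (_ : (fun m : nat => _) = (fun m => T (fun=> setT) m - T EI m)).
  by apply: cvgB; [apply: (vol_cvg _ join_unit_adm)|apply: (vol_cvg _ adm)].
apply/funext => m; rewrite prodE IE quot_dim_join consM natrB ?mulrBl //.
apply: count_upto_sub; apply: sum_upset_sub => i; rewrite /join_family.
by case: unlift => [j|] x.
Qed.

Lemma is_mixed_multE e : is_mixed_mult I J e <->
  forall n0 n, mixed_poly d e n0 n = covolume EI EJ C (cons_index n0 n).
Proof.
split=> [eP n0 n|eE n0 n]; last by rewrite eE; apply: covolume_cvg.
have lim_v := @covolume_cvg n0 n.
exact: cvg_unique (eP n0 n) lim_v.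
Qed.

Lemma mixed_multE n0 n :
  mixed_poly d (mixed_mult R I J) n0 n = covolume EI EJ C (cons_index n0 n).
Proof.
move: n0 n; apply/is_mixed_multE.
have [e eP] := mixed_poly_ex covolume_is_poly covolume_homog covolume0.
apply: (@xgetPex _ (fun _ _ => 0) (is_mixed_mult I J)); exists e.
by apply/is_mixed_multE => n0 n; rewrite eP.
Qed.

Lemma mixed_mult_coef (q : 'I_d'.+1 * {ffun 'I_r -> 'I_d'.+1}) : mixed_index q ->
  mixed_mult R I J q.1 (fun i => q.2 i) =
    mixed_factor q * coef (covolume EI EJ C) (mixed_exponent q).
Proof.
move=> valid_q; rewrite (mixed_poly_coef _ valid_q); congr (_ * coef _ _).
by apply/funext => nu; rewrite mixed_multE cons_index_eta.
Qed.

End Ideals.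
End Family.

Lemma nfoldT n : nfold (setT : set 'X_{1..d}) n = setT.
Proof.
elim: n => [|n IHn] //; apply/seteqP; split=> // x _ /=; rewrite IHn.
by exists 0%MM, x; rewrite add0m.
Qed.

(** The powers of the unit ideal are the unit ideal, so both terms are volumes of
    families of powers. *)
Lemma covolume_power_cvg EI EJ C nu : admissible (join_family EI EJ) C ->
  (fun p : nat => covolume (fun n => nfold (EI p) n) (fun j n => nfold (EJ j p) n)
                    (C * p) nu / p%:R ^+ d) @ \oo --> covolume EI EJ C nu.
Proof.
move=> adm; rewrite /covolume.
have famTE p : join_family (fun=> setT) (fun j n => nfold (EJ j p) n) =
               power_family (join_family (fun=> setT) EJ) p.
  by rewrite -join_power_family; congr join_family; apply/funext => n; rewrite nfoldT.
under eq_fun do rewrite famTE join_power_family mulrBl.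
by apply: cvgB; apply: vol_power_cvg => //; apply: join_unit_adm adm.
Qed.

End MixedVolumes.

(** * Exponents of the given families *)

Section Hypotheses.
Context {k : fieldType} {d : nat}.
Implicit Types (I J : set {mpoly k[d]}).

Lemma irrelevantE : @irrelevant_ideal k d `<=` supported_on [set x | x <> 0%MM].
Proof.
move=> _ [s [sP ->]]; apply: supported_sum => u /sP[_ [i _ <-]].
have := @supportedM k d setT [set x | x <> 0%MM] u.1 'X_i; rewrite supported_setT => Hm.
apply: (supported_sub _ (Hm I _)) => [_ [a [b [_ nb ->]]] /eqP|].
  by rewrite mnmD_eq0 => /andP[_ /eqP].
by apply: supportedX => /eqP; rewrite mnm1_eq0.
Qed.

(** An exponent that is minimal in [J] gives a monomial of [J] that does not
    belong to the product of [J] with the irrelevant ideal, hence its degree is the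
    degree of a minimal generator. *)
Lemma exponents_gen J x : monomial_ideal J -> exponents J x ->
  exists g, [/\ exponents J g, (g <= x)%MM & gen_degree J (mdeg g)].
Proof.
move=> monJ; have [upJ JE] := monomial_idealE monJ.
elim/(well_founded_ind (@ltom_wf d)): x => x IHx Jx.
have [[i [xi Jxi]]|minx] := pselect (exists i, (0 < x i)%N /\ exponents J (x - U_(i))%MM).
  have le_x : (U_(i) <= x)%MM by rewrite lep1mP -lt0n.
  have [|g [Jg le_g deg_g]] := IHx (x - U_(i))%MM _ Jxi.
    by apply: lt_mdeg_ltmc; rewrite -{2}(submK le_x) mdegD mdeg1 addn1.
  by exists g; split=> //; apply: lepm_trans le_g (lem_subr _ _).
exists x; rewrite lepm_refl; split=> //; exists 'X_[x]; split=> //.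
  by rewrite dhomogX.
rewrite JE => irrJ.
have {irrJ} : supported_on (sumset [set x | x <> 0%MM] (exponents J))
    ('X_[x] : {mpoly k[d]}).
  rewrite -idealM_supported; have [s [sP sE]] := irrJ.
  exists s; split=> // u /sP[irr_u J_u].
  by split=> //; apply: irrelevantE.
move/(_ x); rewrite msuppX mem_seq1 eqxx => /(_ isT)[a [b [na Jb xE]]].
have [i ai] : exists i, (0 < a i)%N.
  apply: contrapT => /forallNP a0; apply: na; apply/mnmP => i.
  by rewrite mnm0E; apply/eqP; rewrite -leqn0 leqNgt; apply/negP/a0.
apply: minx; exists i; split; first by rewrite xE mnmDE ltn_addr.
apply: upclosed_le upJ Jb _; apply/mnm_lepP => j; rewrite mnmBE xE mnmDE mnm1E.
by case: eqP => [<-|_]; lia.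
Qed.

(** A power of each variable lies in [I], and a monomial of large degree is
    divisible by one of these powers. *)
Lemma m_primary_big I : (0 < d)%N -> m_primary I -> monomial_ideal I ->
  exists c : nat, forall x, (c <= mdeg x)%N -> exponents I x.
Proof.
move=> d_gt0 [_ radI] monI; have [upI IE] := monomial_idealE monI.
have powX i : exists n : nat, exponents I (U_(i) *+ n)%MM.
  have : radical I 'X_i.
    rewrite radI; exists [:: (1, 'X_i)]; split=> [u|]; last by rewrite big_seq1 mul1r.
    by rewrite mem_seq1 => /eqP ->; split=> //; exists i.
  by move=> [n]; rewrite mpolyXn; exists n.
have [n nP] := boolp.choice powX.
exists (\sum_i n i)%N => x le_x.
have [i le_ni] : exists i, (n i <= x i)%N.
  apply: contrapT => /forallNP lt_x; move: le_x; apply/negP; rewrite -ltnNge mdegE.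
  have i0 := Ordinal d_gt0.
  rewrite (bigD1 i0) //= [ltnRHS](bigD1 i0) //= -addSn leq_add //.
    by rewrite ltnNge; apply/negP/lt_x.
  by apply: leq_sum => i _; rewrite ltnW // ltnNge; apply/negP/lt_x.
apply: upclosed_le upI (nP i) _; apply/mnm_lepP => j; rewrite mulmnE mnm1E.
by case: eqP => [<-|_]; rewrite ?mul1n ?mul0n.
Qed.

Lemma graded_exponents (I : nat -> set {mpoly k[d]}) m n x y : graded_family I ->
  exponents (I m) x -> exponents (I n) y -> exponents (I (m + n)%N) (x + y)%MM.
Proof.
move=> [_ _ ID] Ix Iy; apply: ID; exists [:: ('X_[x], 'X_[y])].
by rewrite big_seq1 mpolyXD; split=> // u; rewrite mem_seq1 => /eqP ->.
Qed.

End Hypotheses.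

Section GivenFamilies.
Context {k : fieldType} {d r : nat}.
Hypothesis d_gt0 : (0 < d)%N.
Variables (I : nat -> set {mpoly k[d]}) (J : 'I_r -> nat -> set {mpoly k[d]}).
Hypothesis I_graded : graded_family I.
Hypothesis I_primary : forall n : nat, (0 < n)%N -> m_primary (I n).
Hypothesis I_monomial : forall n : nat, monomial_ideal (I n).
Hypothesis J_graded : forall i : 'I_r, graded_family (J i).
Hypothesis J_monomial : forall (i : 'I_r) (n : nat), monomial_ideal (J i n).
Hypothesis J_beta : exists beta : nat, forall (i : 'I_r) (n : nat),
  exists b : nat, is_beta (J i n) b /\ (b <= beta * n)%N.

(** If the monomials of degree at least [c] lie in [I 1], those of degree at least
    [c * n] lie in its [n]-th power, hence in [I n]; for the [J], the degrees of
    minimal generators are bounded by assumption. *)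
Lemma exponents_adm : exists C : nat,
  admissible (join_family (fun n => exponents (I n)) (fun i n => exponents (J i n))) C /\
  forall n x, (C * n <= mdeg x)%N -> exponents (I n) x.
Proof.
have [c cP] := m_primary_big d_gt0 (I_primary (ltn0Sn 0)) (I_monomial 1).
have [beta betaP] := J_beta.
have I_0 x : exponents (I 0%N) x by have [_ I0 _] := I_graded; rewrite /exponents I0.
have I_big n x : ((c + beta) * n <= mdeg x)%N -> exponents (I n) x.
  move=> le_x; have {le_x} : nfold (exponents (I 1%N)) n x.
    by apply: nfold_big cP (leq_trans _ le_x); rewrite leq_mul // leq_addr.
  elim: n x => [|n IHn] x //= [u [v [Iu /IHn Iv ->]]].
  by rewrite -add1n; apply: graded_exponents.
exists (c + beta)%N; split=> //.
split=> i; rewrite /join_family; case: (unliftP ord0 i) => [j _|_].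
- by move=> n; have [] := monomial_idealE (J_monomial j n).
- by move=> n; have [] := monomial_idealE (I_monomial n).
- by have [_ J0 _] := J_graded j; rewrite /exponents J0.
- exact: I_0.
- by move=> m n x y; apply: graded_exponents.
- by move=> m n x y; apply: graded_exponents.
- move=> n; have [b [[[f [_ Jf nf]] _] _]] := betaP j n.
  have [x xf] : exists x, x \in msupp f.
    case E : (msupp f) => [|x s]; last by exists x; rewrite mem_head.
    case: nf; move/eqP: E; rewrite msupp_eq0 => /eqP ->.
    by exists [::]; rewrite big_nil.
  exists x; have [_ JE] := monomial_idealE (J_monomial j n).
  by have {}Jf : supported_on (exponents (J j n)) f; [rewrite -JE|apply: Jf].
- move=> n; exists (U_(Ordinal d_gt0) *+ ((c + beta) * n))%MM.
  by apply: I_big; rewrite mdegMn mdeg1 mul1n.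
- move=> n x /(exponents_gen (J_monomial j n))[g [Jg le_g deg_g]]; exists g; split=> //.
  have [b [[_ b_max] le_b]] := betaP j n.
  by rewrite (leq_trans (b_max _ deg_g)) // (leq_trans le_b) // leq_mul // leq_addl.
- move=> n x Ix; have [le_x|/ltnW lt_x] := leqP (mdeg x) ((c + beta) * n).
    by exists x; rewrite lepm_refl.
  have [g [le_g deg_g]] := sub_mdeg lt_x.
  by exists g; rewrite deg_g; split=> //; apply: I_big; rewrite deg_g.
Qed.

End GivenFamilies.

Theorem theoremB (R : realType) (k : fieldType) (d r : nat)
    (I : nat -> set {mpoly k[d]}) (J : 'I_r -> nat -> set {mpoly k[d]})
    (I_graded : graded_family I)
    (I_primary : forall n : nat, (0 < n)%N -> m_primary (I n))
    (I_monomial : forall n : nat, monomial_ideal (I n))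
    (J_graded : forall i : 'I_r, graded_family (J i))
    (J_monomial : forall (i : 'I_r) (n : nat), monomial_ideal (J i n))
    (J_beta : exists beta : nat, forall (i : 'I_r) (n : nat),
       exists b : nat, is_beta (J i n) b /\ (b <= beta * n)%N)
    (d0 : nat) (dd : 'I_r -> nat)
    (d0_dd : (d0 + \sum_(i < r) dd i).+1 = d) :
  (fun p : nat =>
     mixed_mult_ideals R (I p) (fun i => J i p) d0 dd / p%:R ^+ d : R)
    @ \oo --> mixed_mult R I J d0 dd.
Proof.
case: d => [|d'] in I J I_graded I_primary I_monomial J_graded J_monomial J_beta d0_dd *.
  by [].
have [C [adm I_big]] := exponents_adm (ltn0Sn d') I_graded I_primary I_monomial
  J_graded J_monomial J_beta.
have IE n : I n = supported_on (exponents (I n)).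
  by case: (monomial_idealE (I_monomial n)).
have JE i n : J i n = supported_on (exponents (J i n)).
  by case: (monomial_idealE (J_monomial i n)).
have dd_lt i : (dd i < d'.+1)%N.
  by rewrite -d0_dd ltnS (bigD1 i) //= addnCA leq_addr.
have d0_lt : (d0 < d'.+1)%N by rewrite -d0_dd ltnS leq_addr.
pose q : 'I_d'.+1 * {ffun 'I_r -> 'I_d'.+1} := (inord d0, [ffun i => inord (dd i)]).
have q1 : q.1 = d0 :> nat by rewrite /= inordK.
have q2 : (fun i => q.2 i : nat) = dd by apply/funext => i; rewrite /= ffunE inordK.
have valid_q : mixed_index q.
  apply/eqP; rewrite -[RHS]d0_dd q1; congr (_ + _).+1; apply: eq_bigr => i _.
  exact: (congr1 (fun f => f i) q2).
rewrite -q1 -q2 (mixed_mult_coef adm I_big IE JE valid_q).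
pose Fp (p : nat) := covolume (R := R) (fun n => nfold (exponents (I p)) n)
  (fun j n => nfold (exponents (J j p)) n) (C * p).
have multE p : mixed_mult_ideals R (I p) (fun i => J i p) q.1 (fun i => q.2 i) =
    mixed_factor q * coef (Fp p) (mixed_exponent q).
  apply: (@mixed_mult_coef R k d' r (fun n => nfold (exponents (I p)) n)
    (fun j n => nfold (exponents (J j p)) n) (C * p)) valid_q.
  - by have := power_family_adm adm p; rewrite -join_power_family.
  - by move=> n x le_x; apply: nfold_big (I_big p) _.
  - by move=> n; rewrite -idealX_supported -IE.
  - by move=> i n; rewrite -idealX_supported -JE.
under eq_fun do rewrite multE -mulrA.
apply: cvgMl_tmp.
under eq_fun do rewrite mulrC -coef_scale.
apply: coef_cvg => nu.
under eq_fun do rewrite mulrC.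
exact: covolume_power_cvg.
Qed.
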